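(* Let $w\in S_\infty$, let $k\leq l$, and let $\eta=\eta_1+2\eta_2$ be a multi-set with $|\eta_1|+2|\eta_2|=k+l$ such that either $l>k=|\eta_2|+1$ or $l=k=|\eta_2|+2$. Then $m^{k,l}_\eta(w)=1$ if $\eta\in B_{k,l}(w)$, and $m^{k,l}_\eta(w)=0$ otherwise.
   Context: Permutations in $S_\infty$ compose as functions, $s_i$ is the transposition of $i,i+1$, $\ell(w)$ is the length. For $l\geq1$, $w^l$ is the increasing ordering of $w(1),\dots,w(l)$; $A_l(w)$ is the set of strictly increasing sequences $\alpha$ of $l$ positive integers with $\alpha_j\leq w^l_j$ for all $j$ (identified with sets); $s_i\alpha$ is the increasing sequence with entry set $\{s_i(\alpha_j)\}$; $A_{l,i}(w)=\{\alpha\in A_l(w):s_i\alpha\notin A_l(w)\}$. $x^\alpha=\prod_jx_{\alpha_j}$; a multi-set with multiplicities at most 2 is $\eta=\eta_1+2\eta_2$ ($\eta_1,\eta_2$ disjoint sets of elements of multiplicity 1, 2), $x^\eta=\prod_{j\in\eta_1}x_j\prod_{j\in\eta_2}x_j^2$. $T_l=t_1\cdots t_l$. $\pi_if=(x_if-x_{i+1}s_if)/(x_i-x_{i+1})$ with $s_i$ swapping $x_i,x_{i+1}$. For $\ell(s_iw)>\ell(w)$, $N_{w,i}=\prod_{l\geq1}\prod_{\alpha\in A_{l,i}(w)}(1-x^{s_i\alpha}T_l)$; $P_{\mathrm{Id}}=1$, $P_{s_iw}=\pi_i(P_wN_{w,i})$ whenever $\ell(s_iw)>\ell(w)$ (well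 defined). $m^{k,l}_\eta(w)$ is minus the coefficient of $x^\eta T_kT_l$ in $P_w$ (as a polynomial in $x$ and the $T_l$'s). For sets, $\alpha+\beta$ is multi-set union. $B_{k,l}(w)$ is the set of $\eta$ for which there exist $\alpha,\tilde\alpha\in A_l(w)$, $\beta,\tilde\beta\in A_k(w)$ with $\eta=\alpha+\beta=\tilde\alpha+\tilde\beta$ and $\alpha\neq\tilde\alpha$, $\alpha\neq\tilde\beta$, $\beta\neq\tilde\alpha$, $\beta\neq\tilde\beta$. *)

(* Defs.v *)
From HB Require Import structures.
From mathcomp Require Import all_boot all_order all_algebra.
From mathcomp Require Import finmap multiset.
From mathcomp Require Import monalg.
From mathcomp Require Import ring zify.

Set Implicit Arguments.
Unset Strict Implicit.
Unset Printing Implicit Defensive.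

Import GRing.Theory.

Local Open Scope fset_scope.
Local Open Scope nat_scope.

(* Labels are shifted by one throughout: the natural number j stands for the
   positive integer j+1.  So S_oo is the set of injective finitely supported
   maps nat -> nat, and simple i exchanges i and i.+1, for every i >= 0.
   Cardinalities (the indices k, l of w^l, A_l(w), T_l) are not shifted. *)

Definition simple (i : nat) : {fsfun nat -> nat} :=
  [fsfun j in [fset i; i.+1] => if j == i then i.+1 else i].

(* Every j >= supp_bound w is fixed by w. *)
Definition supp_bound (w : {fsfun nat -> nat}) : nat := \max_(j <- finsupp w) j.+1.

(* Number of inversions: pairs i < j with w j < w i.  When w is injective they
   all satisfy j < supp_bound w, see inversion_bnd. *)
Definition perm_len (w : {fsfun nat -> nat}) : nat :=
  \sum_(0 <= j < supp_bound w) \sum_(0 <= i < j) (w j < w i).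

Definition wsort (l : nat) (w : {fsfun nat -> nat}) : seq nat :=
  sort leq [seq w j | j <- iota 0 l].

(* A strictly increasing sequence is identified with its set of entries. *)
Definition in_A (l : nat) (w : {fsfun nat -> nat}) (alpha : {fset nat}) : bool :=
  (#|` alpha| == l) &&
  [forall j : 'I_l, nth 0 (sort leq alpha) j <= nth 0 (wsort l w) j].

(* All alpha satisfying in_A have their entries below the bound used here to get
   a finite set, see mem_Aset. *)
Definition Aset (l : nat) (w : {fsfun nat -> nat}) : {fset {fset nat}} :=
  [fset alpha in fpowerset [fset j in iota 0 (\max_(0 <= j < l) (w j).+1)]
     | in_A l w alpha].

Definition sact (i : nat) (alpha : {fset nat}) : {fset nat} :=
  [fset simple i j | j in alpha].

Definition Aiset (l i : nat) (w : {fsfun nat -> nat}) : {fset {fset nat}} :=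
  [fset alpha in Aset l w | sact i alpha \notin Aset l w].

Implicit Types (w : {fsfun nat -> nat}) (alpha : {fset nat}).

Lemma simpleE i j :
  simple i j = if j == i then i.+1 else if j == i.+1 then i else j.
Proof. by rewrite fsfunE !inE; case: eqP; case: eqP. Qed.

Lemma simpleK i : involutive (simple i).
Proof.
move=> j; rewrite !simpleE; case: (eqVneq j i) => [->|ji].
  by rewrite eqxx; case: eqP => // /esym/n_Sn.
by case: (eqVneq j i.+1) => [->|ji1]; rewrite ?eqxx // (negbTE ji) (negbTE ji1).
Qed.

Lemma simple_inj i : injective (simple i).
Proof. exact: inv_inj (simpleK i). Qed.

Lemma bnd_fix w j : supp_bound w <= j -> w j = j.
Proof.
move=> le; apply: fsfun_dflt; apply: contraTN le => jw.
by rewrite -ltnNge /supp_bound (big_fsetD1 j) //= leq_max ltnSn.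
Qed.

Lemma lt_bnd w j : injective w -> j < supp_bound w -> w j < supp_bound w.
Proof.
move=> wI jb; rewrite ltnNge; apply: contraTN jb => le.
by rewrite -leqNgt -(wI _ _ (bnd_fix le)).
Qed.

Lemma inversion_bnd w i j : injective w -> i < j -> w j < w i -> j < supp_bound w.
Proof.
move=> wI ij; rewrite ltnNge [j < _]ltnNge; apply: contraNN => le.
rewrite (bnd_fix le); case: (ltnP i (supp_bound w)) => [ib|/bnd_fix -> ]; last exact: ltnW.
by apply: leq_trans le; apply/ltnW/lt_bnd.
Qed.

Lemma mem_Aset l w alpha : (alpha \in Aset l w) = in_A l w alpha.
Proof.
rewrite !inE /=; case inA: in_A; rewrite ?andbF // andbT.
rewrite fpowersetE; apply/fsubsetP => a aa; rewrite !inE /= mem_iota add0n /=.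
case/andP: inA => /eqP sz /forallP le.
have as_ : a \in sort leq alpha by rewrite mem_sort.
have ilt : index a (sort leq alpha) < l.
  by rewrite -[X in _ < X]sz -(size_sort leq) index_mem.
have := le (Ordinal ilt); rewrite /= nth_index // => /leq_ltn_trans; apply.
have : nth 0 (wsort l w) (index a (sort leq alpha)) \in wsort l w.
  by rewrite mem_nth // size_sort size_map size_iota.
rewrite mem_sort => /mapP [j]; rewrite mem_iota add0n => /= jl ->.
by rewrite big_mkord (bigmax_sup (Ordinal jl)).
Qed.

Lemma mem_Aiset l i w alpha :
  (alpha \in Aiset l i w) = in_A l w alpha && ~~ in_A l w (sact i alpha).
Proof. by rewrite in_fset /= inE /= -!mem_Aset. Qed.

Lemma wsort_id l w : injective w -> supp_bound w <= l -> wsort l w = iota 0 l.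
Proof.
move=> wI le; have ub : uniq [seq w j | j <- iota 0 l].
  by rewrite map_inj_uniq ?iota_uniq.
have sub : {subset [seq w j | j <- iota 0 l] <= iota 0 l}.
  move=> _ /mapP [j + ->]; rewrite !mem_iota !add0n /= => jl.
  case: (ltnP j (supp_bound w)) => [/(lt_bnd wI)|/bnd_fix -> //].
  by move/leq_trans; apply.
apply: (sorted_eq leq_trans anti_leq); rewrite ?sort_sorted ?iota_sorted //.
  exact: leq_total.
rewrite perm_sort; apply: uniq_perm => //; first exact: iota_uniq.
by case: (uniq_min_size ub sub); rewrite ?size_map.
Qed.

(* All but finitely many of the sets A_{l,i}(w) are empty. *)
Lemma Aiset_eq0 l i w : injective w -> maxn (supp_bound w) i.+2 <= l -> Aiset l i w = fset0.
Proof.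
move=> wI; rewrite geq_max => /andP [bl il]; apply/fsetP => alpha.
rewrite in_fset0 mem_Aiset; apply/negP => /andP [inA /negP]; apply.
suff -> : sact i alpha = alpha by [].
have -> : alpha = [fset j in iota 0 l].
  case/andP: inA => /eqP sz /forallP le; apply/eqP.
  rewrite eqEfcard; apply/andP; split; last first.
    by rewrite card_fseq undup_id ?iota_uniq // size_iota sz.
  apply/fsubsetP => a aa; rewrite !inE /= mem_iota add0n /=.
  have as_ : a \in sort leq alpha by rewrite mem_sort.
  have ilt : index a (sort leq alpha) < l.
    by rewrite -[X in _ < X]sz -(size_sort leq) index_mem.
  have := le (Ordinal ilt); rewrite /= nth_index // wsort_id // nth_iota //.
  by move/leq_ltn_trans; apply.
have s_lt j : j < l -> simple i j < l.
  by move=> jl; rewrite simpleE; do 2?case: ifP => // _; rewrite // ltnW.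
apply/fsetP => j; rewrite !inE /= mem_iota add0n /=; apply/imfsetP/idP => /=.
  by case=> a; rewrite !inE /= mem_iota add0n /= => /s_lt al ->.
move=> jl; exists (simple i j); last by rewrite simpleK.
by rewrite !inE /= mem_iota add0n /= s_lt.
Qed.

(* Z[x_1, x_2, ...; t_1, t_2, ...], where inl j and inr j index the variables x
   and t with label j. *)
Definition xt : choiceType := (nat + nat)%type.
Notation poly_xt := {malg int[{cmonom xt}]}.

Definition xmon (s : seq nat) : {cmonom xt} :=
  \big[mmul/mone]_(j <- s) ucm (inl j).

Definition Tmon (l : nat) : {cmonom xt} :=
  \big[mmul/mone]_(0 <= j < l) ucm (inr j).

Definition swap_var (i : nat) (v : xt) : xt :=
  match v with inl j => inl (simple i j) | inr j => inr j end.

Definition swap_mon (i : nat) (m : {cmonom xt}) : {cmonom xt} :=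
  [cmonom m (swap_var i v) | v in swap_var i @` finsupp m]%M.

Local Open Scope ring_scope.

(* Locked, since unifying two monomials by unfolding does not terminate in
   practice. *)
HB.lock Definition mon (m : {cmonom xt}) : poly_xt := << m >>.

Definition xvar (j : nat) : poly_xt := mon (ucm (inl j)).

Definition swap_poly (i : nat) (f : poly_xt) : poly_xt :=
  mmap malgC (fun m => mon (swap_mon i m)) f.

Lemma swap_varK i : involutive (swap_var i).
Proof. by case=> j //=; rewrite simpleK. Qed.

Lemma swap_monE i m v : swap_mon i m v = m (swap_var i v).
Proof.
rewrite cmE fsfun_fun; case: ifPn => // /negP h; apply/esym/eqP.
rewrite cmE_eq0; apply/negP => vm; apply: h.
by apply/imfsetP; exists (swap_var i v); rewrite //= swap_varK.
Qed.

Lemma mon1 : mon mone = 1.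
Proof. by rewrite mon.unlock. Qed.

Lemma monM (m1 m2 : {cmonom xt}) : mon m1 * mon m2 = mon (mmul m1 m2).
Proof. by rewrite !mon.unlock malgM_def fgmulUU mulr1. Qed.

Lemma xvarX j n : xvar j ^+ n = mon [cmonom n | _ in [fset inl j : xt]]%M.
Proof.
elim: n => [|n IH].
  rewrite expr0 -mon1; congr mon; apply/eqP/cmP => v.
  by rewrite cm1 cmE fsfun_fun; case: ifP.
rewrite exprS IH monM; congr mon; apply/eqP/cmP => v.
by rewrite cmM cmU !cmE !fsfun_fun !inE eq_sym; case: eqP.
Qed.

Lemma demazure_monomial (R : comNzRingType) (r x y : R) (a b : nat) :
  exists g, (x - y) * g = x * (r * x ^+ a * y ^+ b) - y * (r * x ^+ b * y ^+ a).
Proof.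
have [ba|/ltnW ab] := leqP b a.
  exists (r * (x * y) ^+ b *
    \sum_(j < (a - b).+1) x ^+ ((a - b).+1.-1 - j) * y ^+ j).
  rewrite mulrCA -subrXX -{3 4}(subnK ba) !exprS !exprD exprMn; ring.
have [<-|/negbTE ne] := eqVneq a b.
  exists (r * x ^+ a * y ^+ a); ring.
have {ne}ab : (a < b)%N by rewrite ltn_neqAle ne.
exists (- (r * (x * y) ^+ a.+1 *
    \sum_(j < b - a.+1) x ^+ ((b - a.+1).-1 - j) * y ^+ j)).
rewrite mulrN mulrCA -subrXX -{3 4}(subnK ab) !exprD exprMn !exprS; ring.
Qed.

Lemma demazure_add (R : comNzRingType) (x y c m m' f f' h g : R) :
  (x - y) * h = x * m - y * m' -> (x - y) * g = x * f - y * f' ->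
  (x - y) * (c * h + g) = x * (c * m + f) - y * (c * m' + f').
Proof. by move=> hE gE; rewrite mulrDr mulrCA hE gE; ring. Qed.

Lemma demazure_mon i (m : {cmonom xt}) : exists g : poly_xt,
  (xvar i - xvar i.+1) * g = xvar i * mon m - xvar i.+1 * mon (swap_mon i m).
Proof.
pose a := m (inl i); pose b := m (inl i.+1).
pose r := mon [cmonom m v | v in finsupp m `\` [fset inl i; inl i.+1]]%M.
have ni : (i.+1 == i) = false by apply/eqP => /esym/n_Sn.
have niE : (inl i.+1 == inl i :> xt) = false by apply/eqP => -[/esym/n_Sn].
have dec (m' : {cmonom xt}) c d : m' (inl i) = c -> m' (inl i.+1) = d ->
    (forall v, v != inl i -> v != inl i.+1 -> m' v = m v) ->
    mon m' = r * xvar i ^+ c * xvar i.+1 ^+ d.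
  move=> mc md mv; rewrite (xvarX i c) (xvarX i.+1 d) /r !monM; congr mon.
  apply/eqP/cmP => v; rewrite !cmM !cmE !fsfun_fun !inE.
  case: (eqVneq v (inl i)) => [->|vi] /=.
    by rewrite mc eq_sym niE addn0.
  case: (eqVneq v (inl i.+1)) => [->|vi1] /=; first by rewrite md.
  by rewrite !addn0 mv //; case: ifP => // /negbT; rewrite -cmE_eq0 => /eqP.
have -> := dec m a b erefl erefl (fun _ _ _ => erefl).
have -> : mon (swap_mon i m) = r * xvar i ^+ b * xvar i.+1 ^+ a.
  apply: dec => [||[j|j]]; rewrite swap_monE //= simpleE ?eqxx ?ni //.
  by move=> h1 h2; do !case: eqP => [jE|_] //; move: h1 h2; rewrite jE ?eqxx.
exact: demazure_monomial.
Qed.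

Lemma swap_polyD i : {morph swap_poly i : f g / f + g}.
Proof. exact: mmapD. Qed.

Lemma swap_poly0 i : swap_poly i 0 = 0.
Proof. exact: mmap0. Qed.

Lemma swap_polyU i c m : swap_poly i << c *g m >> = c%:MP * mon (swap_mon i m).
Proof. by rewrite /swap_poly mmapU. Qed.

Lemma demazure_ex i (f : poly_xt) : exists g : poly_xt,
  (xvar i - xvar i.+1) * g == xvar i * f - xvar i.+1 * swap_poly i f.
Proof.
rewrite [f]monalgE; elim/big_rec: _ => [|m f' _ [g /eqP gE]].
  by exists 0; rewrite swap_poly0 !mulr0 subr0.
have [h hE] := demazure_mon i m.
exists ((f@_m)%:MP * h + g); apply/eqP.
rewrite swap_polyD swap_polyU.
have -> : << f@_m *g m >> = (f@_m)%:MP * mon m :> poly_xt.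
  by rewrite mon.unlock malgM_def fgmulUU mulr1 mul1m.
exact: (demazure_add _ hE gE).
Qed.

(* The quotient (x_i f - x_{i+1} s_i f) / (x_i - x_{i+1}); it exists and is
   unique by demazureE and demazure_uniq. *)
Definition demazure (i : nat) (f : poly_xt) : poly_xt := xchoose (demazure_ex i f).

Lemma demazureE i f : (xvar i - xvar i.+1) * demazure i f =
  xvar i * f - xvar i.+1 * swap_poly i f.
Proof. exact/eqP/(xchooseP (demazure_ex i f)). Qed.

Lemma mcoeff_monM u (g : poly_xt) k :
  (mon u * g)@_k = \sum_(k' <- msupp g | mmul u k' == k) g@_k'.
Proof.
rewrite mon.unlock malgM_def fgmulUg (raddf_sum (mcoeff k)) [RHS]big_mkcond /=.
apply: eq_bigr => k' _; rewrite mcoeffU mul1r; case: eqP => _; rewrite ?mulr1n //.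
Qed.

Lemma demazure_reg i (f : poly_xt) : (xvar i - xvar i.+1) * f = 0 -> f = 0.
Proof.
move=> eq0; apply/malgP => m0; rewrite mcoeff0; apply/eqP.
rewrite mcoeff_eq0; apply/negP => m0f.
have [m mf mmax] : exists2 m, m \in msupp f &
    forall m', m' \in msupp f -> (m' (inl i) <= m (inl i))%N.
  have [x xin xmax] := @arg_maxnP _ [` m0f] xpredT (fun m : msupp f => (val m) (inl i)) isT.
  by exists (val x) => [|m' m'f]; [exact: valP | exact: (xmax [` m'f])].
pose k := mmul (ucm (inl i)) m.
have E : (xvar i * f)@_k - (xvar i.+1 * f)@_k = 0.
  by rewrite -mcoeffB -mulrBl eq0 mcoeff0.
have E1 : (xvar i * f)@_k = f@_m.
  rewrite mcoeff_monM big_mkcond (bigD1_seq m) ?fset_uniq //= eqxx.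
  rewrite big1 ?addr0 // => m' /eqP ne; case: eqP => // /eqP/cmP eqm; case: ne.
  by apply/eqP/cmP => v; have := eqm v; rewrite !cmM => /addnI.
have E2 : (xvar i.+1 * f)@_k = 0.
  rewrite mcoeff_monM big1_seq // => m' /andP [/eqP/eqP/cmP eqm m'f].
  have := mmax _ m'f; have := eqm (inl i); rewrite !cmM !cmU eqxx.
  case: eqP => [[/esym/n_Sn //]|_ /=].
  by rewrite add0n add1n => ->; rewrite ltnn.
have : f@_m = 0.
  exact: etrans (esym E1) (etrans (subr0_eq E) E2).
by apply/eqP; rewrite mcoeff_neq0.
Qed.

Lemma demazure_uniq i (f g : poly_xt) :
  (xvar i - xvar i.+1) * g = xvar i * f - xvar i.+1 * swap_poly i f ->
  g = demazure i f.
Proof.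
rewrite -demazureE => E; apply: subr0_eq; apply: (@demazure_reg i).
by rewrite mulrBr E subrr.
Qed.

(* N_{w,i}: by Aiset_eq0 every factor with l >= maxn (supp_bound w) i.+2 is 1. *)
Definition Nprod (w : {fsfun nat -> nat}) (i : nat) : poly_xt :=
  \prod_(1 <= l < maxn (supp_bound w) i.+2) \prod_(alpha <- Aiset l i w)
    (1 - mon (mmul (xmon (sact i alpha)) (Tmon l))).

(* is_P w p: p is the value of P_w computed by the recursion along some chain of
   length-increasing steps from Id to w (such a chain exists, see is_P_ex).  That
   p does not depend on the chain is not built in. *)
Inductive is_P : {fsfun nat -> nat} -> poly_xt -> Prop :=
| is_P_id : is_P [fsfun of j => j] 1
| is_P_simple w p i : is_P w p -> (perm_len w < perm_len (fsfun_comp (simple i) w))%N ->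
    is_P (fsfun_comp (simple i) w) (demazure i (p * Nprod w i)).

(* The exponent of T_l in a monomial in the T's is the difference of the exponents
   of t_l and t_(l+1) in the corresponding monomial in the t's.  So distinct
   T-monomials are distinct t-monomials, and the coefficient of x^eta T_k T_l can
   be read off in the variables x and t. *)
Definition mcoef (p : poly_xt) (k l : nat) (eta : {mset nat}%mset) : int :=
  - p@_(mmul (xmon eta) (mmul (Tmon k) (Tmon l))).

Definition in_B (k l : nat) (w : {fsfun nat -> nat}) (eta : {mset nat}%mset) : Prop :=
  exists alpha alpha' beta beta' : {fset nat},
    [/\ alpha \in Aset l w, alpha' \in Aset l w, beta \in Aset k w & beta' \in Aset k w] /\
    [/\ eta = (seq_mset alpha `+` seq_mset beta)%mset,
        eta = (seq_mset alpha' `+` seq_mset beta')%mset &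
        [/\ alpha != alpha', alpha != beta', beta != alpha' & beta != beta']].

Local Open Scope nat_scope.

Lemma lenE w M : injective w -> supp_bound w <= M ->
  perm_len w = \sum_(0 <= j < M) \sum_(0 <= i < j) (w j < w i).
Proof.
move=> wI le; rewrite (big_cat_nat (leq0n _) le) /= -/(perm_len w).
rewrite [X in _ + X]big_nat big1 ?addn0 // => j /andP [bj _].
rewrite big_nat big1 // => i /andP [_ ij]; case inv: (w j < w i) => //.
by have := inversion_bnd wI ij inv; rewrite ltnNge bj.
Qed.

Lemma len_simple w i a b : injective w -> a < b -> w a = i.+1 -> w b = i ->
  perm_len (fsfun_comp (simple i) w) < perm_len w.
Proof.
move=> wI ab wa wb; set v := (fsfun_comp _ _).
have vI : injective v by apply: fscomp_inj => //; apply: simple_inj.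
have vE j : v j = simple i (w j) by rewrite fscompE.
pose M := (maxn b.+1 (maxn (supp_bound v) (supp_bound w))).
have bM : b < M by rewrite leq_max ltnSn.
have bvM : supp_bound v <= M by rewrite !leq_max leqnn orbT.
have bwM : supp_bound w <= M by rewrite !leq_max leqnn !orbT.
rewrite (lenE vI bvM) (lenE wI bwM).
have le c d : c < d -> (v d < v c) <= (w d < w c).
  move=> cd; rewrite !vE !simpleE.
  have nc : ~ (w c = i /\ w d = i.+1).
    case=> wc wd; have cb : c = b by apply: wI; rewrite wc.
    by have da : d = a; [apply: wI; rewrite wd | move: cd; rewrite cb da ltnNge ltnW].
  have nd : w c <> w d by move=> /wI E; rewrite E ltnn in cd.
  by case: (w c =P i); case: (w d =P i); case: (w c =P i.+1); case: (w d =P i.+1); lia.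
have bI : b \in index_iota 0 M by rewrite mem_index_iota.
have aI : a \in index_iota 0 b by rewrite mem_index_iota.
rewrite (bigD1_seq b) ?iota_uniq //= [X in _ < X](bigD1_seq b) ?iota_uniq //=.
rewrite -addSn; apply: leq_add; last first.
  by apply: leq_sum => d _; rewrite !big_nat; apply: leq_sum => c /andP [_ /le].
rewrite (bigD1_seq a) ?iota_uniq //= [X in _ < X](bigD1_seq a) ?iota_uniq //=.
have -> : (v b < v a) = false.
  rewrite !vE wa wb !simpleE eqxx (_ : (i.+1 == i) = false); last exact/eqP/nesym/n_Sn.
  by rewrite eqxx ltnNge leqnSn.
have -> : (w b < w a) = true by rewrite wa wb ltnSn.
rewrite add0n add1n ltnS.
rewrite big_seq_cond [X in _ <= X]big_seq_cond.
by apply: leq_sum => c /andP []; rewrite mem_index_iota => /andP [_ /le].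
Qed.

Lemma fsinj_surj w v : injective w -> exists u, w u = v.
Proof.
move=> wI; case: (ltnP v (supp_bound w)) => [vb|/bnd_fix]; last by exists v.
have : v \in wsort (supp_bound w) w by rewrite wsort_id // mem_iota.
by rewrite mem_sort => /mapP [u _ ->]; exists u.
Qed.

Lemma descent_ex w : injective w ->
  w = [fsfun of j => j] \/ exists i a b, [/\ a < b, w a = i.+1 & w b = i].
Proof.
move=> wI; case: (boolP [exists a : 'I_(supp_bound w), exists b : 'I_(supp_bound w),
    (a < b) && (w a == (w b).+1)]) => [/existsP [a /existsP [b /andP [ab /eqP E]]]|nd].
  by right; exists (w b), a, b.
left; have {}nd a b : w a = (w b).+1 -> b < a.
  move=> E; rewrite ltnNge leq_eqVlt; apply/negP => /predU1P [ab|ab].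
    by move: E; rewrite ab => /n_Sn.
  have inv : w b < w a by rewrite E.
  have bb := inversion_bnd wI ab inv; have ba := ltn_trans ab bb.
  move/negP: nd; apply; apply/existsP; exists (Ordinal ba).
  by apply/existsP; exists (Ordinal bb); rewrite /= ab E eqxx.
have le v : forall u, w u = v -> v <= u.
  elim: v => [//|v IH] u wu; have [u' wu'] := fsinj_surj v wI.
  by apply: leq_ltn_trans (IH _ wu') _; apply: nd; rewrite wu wu'.
apply/fsfunP => u; rewrite fsfun0E; elim/ltn_ind: u => u IH.
have := le _ u erefl; rewrite leq_eqVlt => /predU1P [//|lt].
by have := wI _ _ (IH _ lt) => E; rewrite E ltnn in lt.
Qed.

Lemma is_P_ex w : injective w -> exists p, is_P w p.
Proof.
have [n] := ubnP (perm_len w); elim: n w => // n IH w lt wI.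
case: (descent_ex wI) => [->|[i [a [b [ab wa wb]]]]].
  by exists 1%R; apply: is_P_id.
have ll := len_simple wI ab wa wb; set v := (fsfun_comp (simple i) w) in ll.
have vI : injective v by apply: fscomp_inj => //; apply: simple_inj.
have [p Pv] := IH v (leq_trans ll lt) vI.
have E : w = (fsfun_comp (simple i) v).
  by apply/fsfunP => j; rewrite !fscompE /= fscompE /= simpleK.
by exists (demazure i (p * Nprod v i))%R; rewrite {1}E; apply: is_P_simple; rewrite -?E.
Qed.

(* Main.v *)
Require Import Defs.
From mathcomp Require Import all_boot all_order all_algebra.
From mathcomp Require Import finmap multiset.
From mathcomp Require Import monalg.
From mathcomp Require Import ring zify.

(* In the grading by the degree in the T_l (the exponent of t_1), P_w = 1 + (terms
   of degree >= 2), so in degree 2 the coefficients of P_w N_{w,i} are those of P_w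
   plus the number of unordered pairs of factors x^alpha T_a, x^beta T_b of N_{w,i}
   with the given product.  Here alpha, beta run over the sets that are in
   A(s_i w) but not in A(w); they contain i+1 and not i, so these pairs only occur
   for monomials with exponents (0, 2) at (i, i+1).  Under pi_i they only matter
   for the eta in which i and i+1 both have multiplicity one: there m_eta grows by
   the number of such pairs for eta - {i} + {i+1}, the other terms of pi_i being
   zero since they have one more double element.  The theorem then follows by
   induction along the recursion.  For k < l the splittings of eta in A_k x A_l
   are indexed by an interval of eta_1, cut out by two families of counting
   inequalities; for k = l they are among the three ways of splitting the four
   elements of eta_1 into pairs.  In both cases, if s_i w allows two splittings
   exchanged by s_i and w only allows one of them, then w allows a third one. *)

Set Implicit Arguments.
Unset Strict Implicit.
Unset Printing Implicit Defensive.

Import GRing.Theory.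

Local Open Scope fset_scope.
Local Open Scope nat_scope.

Implicit Types (w : {fsfun nat -> nat}) (A B V : {fset nat}) (u v : {cmonom xt})
  (f g p : poly_xt).

(** * Coefficients of the Demazure operator and of products *)

Local Open Scope ring_scope.

Lemma cmonomP u v : (forall x, u x = v x) -> u = v.
Proof. by move=> h; apply/eqP/cmP. Qed.

Lemma mmulI u v v' : mmul u v = mmul u v' -> v = v'.
Proof.
move=> h; apply: cmonomP => x; have := congr1 (fun m : {cmonom xt} => m x) h.
by rewrite !cmM => /addnI.
Qed.

Lemma mcoeff_mon u v : (mon u)@_v = (u == v)%:R.
Proof. by rewrite mon.unlock mcoeffU1. Qed.

Lemma mcoeff_monMl u v g : (mon u * g)@_(mmul u v) = g@_v.
Proof.
rewrite mcoeff_monM; case: (boolP (v \in msupp g)) => vg.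
  rewrite big_mkcond (bigD1_seq v) ?fset_uniq //= eqxx big1 ?addr0 // => v' /eqP ne.
  by case: eqP => // /mmulI /ne.
rewrite (mcoeff_outdom vg) big_seq_cond big1 // => v' /andP [v'g /eqP/mmulI v'v].
by rewrite -v'v v'g in vg.
Qed.

Lemma mcoeff_monM0 u v g : (forall v', mmul u v' != v) -> (mon u * g)@_v = 0.
Proof. by move=> h; rewrite mcoeff_monM big1 // => v' /eqP E; have := h v'; rewrite E eqxx. Qed.

Lemma mcoeff_xvar0 j g u : u (inl j) = 0%N -> (xvar j * g)@_u = 0.
Proof.
move=> u0; apply: mcoeff_monM0 => v; apply/eqP => /(congr1 (fun m : {cmonom xt} => m (inl j))).
by rewrite cmM cmU eqxx u0.
Qed.

Lemma swap_monK i : involutive (swap_mon i).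
Proof. by move=> u; apply: cmonomP => v; rewrite !swap_monE swap_varK. Qed.

Lemma mcoeff_swap i f u : (swap_poly i f)@_u = f@_(swap_mon i u).
Proof.
rewrite {2}[f]monalgE /swap_poly mmapE (raddf_sum (mcoeff u)) (raddf_sum (mcoeff (swap_mon i u))).
apply: eq_bigr => m _ /=.
rewrite mcoeffCM mcoeff_mon mcoeffU (inv_eq (@swap_monK i)).
by case: (m == _); rewrite ?mulr1 ?mulr0.
Qed.

(** The operator [demazure i] only relates monomials that agree outside x_i and x_(i+1). Freezing
    the rest of [u] turns its coefficients into a two-index table in the exponents [a], [b]. *)
Definition setx (i : nat) u (a b : nat) : {cmonom xt} :=
  [cmonom (if v == inl i then a else if v == inl i.+1 then b else u v)
     | v in inl i |` (inl i.+1 |` finsupp u)]%M.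

Lemma setxE i u a b x :
  setx i u a b x = if x == inl i then a else if x == inl i.+1 then b else u x.
Proof.
rewrite cmE fsfun_fun !inE; case: (x == _) => //=; case: (x == _) => //=.
by case: ifP => // /negbT; rewrite -cmE_eq0 => /eqP.
Qed.

Lemma inlS_eqF i : (inl i.+1 == inl i :> xt) = false.
Proof. by apply/eqP => -[] /esym/n_Sn. Qed.

Lemma setxl i u a b : setx i u a b (inl i) = a.
Proof. by rewrite setxE eqxx. Qed.

Lemma setxr i u a b : setx i u a b (inl i.+1) = b.
Proof. by rewrite setxE inlS_eqF eqxx. Qed.

Lemma setxo i u a b j : j != i -> j != i.+1 -> setx i u a b (inl j) = u (inl j).
Proof. by move=> /negbTE h1 /negbTE h2; rewrite setxE !(inj_eq inl_inj) h1 h2. Qed.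

Lemma setx_inr i u a b j : setx i u a b (inr j) = u (inr j).
Proof. by rewrite setxE. Qed.

Lemma setx_id i u : setx i u (u (inl i)) (u (inl i.+1)) = u.
Proof. by apply: cmonomP => x; rewrite setxE; do 2?case: eqP => [->|_] //. Qed.

Lemma swap_setx i u a b : swap_mon i (setx i u a b) = setx i u b a.
Proof.
apply: cmonomP => -[j|j]; rewrite swap_monE ?setx_inr //= simpleE.
case: (eqVneq j i) => [->|ji]; first by rewrite setxr setxl.
by case: (eqVneq j i.+1) => [->|ji1]; rewrite ?setxr ?setxl // !setxo.
Qed.

Lemma mulxl_setx i u a b : mmul (ucm (inl i)) (setx i u a b) = setx i u a.+1 b.
Proof.
apply: cmonomP => x; rewrite cmM cmU !setxE ![inl i == _]eq_sym.
by case: (x == inl i).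
Qed.

Lemma mulxr_setx i u a b : mmul (ucm (inl i.+1)) (setx i u a b) = setx i u a b.+1.
Proof.
apply: cmonomP => x; rewrite cmM cmU !setxE ![inl i.+1 == _]eq_sym.
case: (eqVneq x (inl i)) => [->|_]; first by rewrite eq_sym inlS_eqF.
by case: (x == _).
Qed.

Section DemazureCoefficients.
Variables (i : nat) (f : poly_xt) (u : {cmonom xt}).
Let F a b := f@_(setx i u a b).
Let G a b := (demazure i f)@_(setx i u a b).

Let demE m : (xvar i * demazure i f)@_m - (xvar i.+1 * demazure i f)@_m =
  (xvar i * f)@_m - (xvar i.+1 * swap_poly i f)@_m.
Proof.
have B (a b c d : poly_xt) : a - b = c - d -> a@_m - b@_m = c@_m - d@_m.
  by move=> E; rewrite -(mcoeffB m a b) E (mcoeffB m c d).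
have gen (R : nzRingType) (x y z s t : R) : (x - y) * z = s - t -> x * z - y * z = s - t.
  by rewrite mulrBl.
exact: B (gen _ _ _ _ _ _ (demazureE i f)).
Qed.

Let xl g a b : (xvar i * g)@_(setx i u a.+1 b) = g@_(setx i u a b).
Proof. by rewrite -mulxl_setx mcoeff_monMl. Qed.

Let xr g a b : (xvar i.+1 * g)@_(setx i u a b.+1) = g@_(setx i u a b).
Proof. by rewrite -mulxr_setx mcoeff_monMl. Qed.

Let xls g a : (xvar i * g)@_(setx i u 0 a) = 0.
Proof. by rewrite mcoeff_xvar0 ?setxl. Qed.

Let xrs g a : (xvar i.+1 * g)@_(setx i u a 0) = 0.
Proof. by rewrite mcoeff_xvar0 ?setxr. Qed.

Let xrw a b : (xvar i.+1 * swap_poly i f)@_(setx i u a b.+1) = F b a.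
Proof. by rewrite xr mcoeff_swap swap_setx. Qed.

Let subst4 (x x' y y' z z' t t' : int) : x - y = z - t ->
  x = x' -> y = y' -> z = z' -> t = t' -> x' - y' = z' - t'.
Proof. by move=> + <- <- <- <-. Qed.

Lemma demazure_coef0 a : G a 0 = F a 0.
Proof.
have := subst4 (demE (setx i u a.+1 0)) (xl _ _ _) (xrs _ _) (xl _ _ _) (xrs _ _).
by rewrite !subr0.
Qed.

(** Compare coefficients at exponents (a+1, b+1) in (x_i - x_(i+1)) pi_i f = x_i f - x_(i+1) s_i
    f. *)
Lemma demazure_coefS a b : G a b.+1 = G a.+1 b + F a b.+1 - F b a.+1.
Proof.
have := subst4 (demE (setx i u a.+1 b.+1)) (xl _ _ _) (xr _ _ _) (xl _ _ _) (xrw _ _).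
rewrite -/(G _ _) -/(G _ _) -/(F _ _) => h.
by rewrite -addrA -h addrC subrK.
Qed.

Lemma demazure_coefC a b : G a b = G b a.
Proof.
elim: b a => [|b IH] a; last first.
  by rewrite (demazure_coefS a b) IH (demazure_coefS b a); ring.
rewrite demazure_coef0; case: a => [|a]; first by rewrite demazure_coef0.
(* At exponents (0, a+2) both multiples of x_i vanish, which leaves G 0 (a+1) = F (a+1) 0. *)
have := subst4 (demE (setx i u 0 a.+2)) (xls _ _) (xr _ _ _) (xls _ _) (xrw _ _).
by rewrite !sub0r => /oppr_inj/esym.
Qed.

Lemma demazure_coef11 : G 1 1 = F 1 1 + F 2 0 - F 0 2.
Proof. by rewrite demazure_coefS demazure_coef0; ring. Qed.

Lemma demazure_coef21 : G 2 1 = F 2 1 + F 3 0 - F 0 3.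
Proof. by rewrite demazure_coefS demazure_coef0; ring. Qed.

Lemma demazure_coef22 : G 2 2 = F 2 2 + F 3 1 + F 4 0 - F 1 3 - F 0 4.
Proof. by rewrite !demazure_coefS demazure_coef0; ring. Qed.

(* The coefficient of [x_i^a x_(i+1)^b] only involves exponents of the same sum
   whose maximum is at least as large. *)
Lemma demazure_coef_eq0 a b :
  (forall c d, (c + d = a + b)%N -> (maxn a b <= maxn c d)%N -> F c d = 0) -> G a b = 0.
Proof.
wlog ba : a b / (b <= a)%N => [W h|].
  case/orP: (leq_total b a) => ab; first exact: W.
  by rewrite demazure_coefC; apply: W => // c d; rewrite [(b + a)%N]addnC [maxn b a]maxnC; apply: h.
elim: b a ba => [|b IH] a ba h; first by rewrite demazure_coef0 h.
rewrite demazure_coefS IH ?h //; try lia.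
by move=> c d cd le; apply: h; lia.
Qed.

End DemazureCoefficients.
Arguments demazure_coef0 : clear implicits.
Arguments demazure_coefC : clear implicits.
Arguments demazure_coef11 : clear implicits.
Arguments demazure_coef21 : clear implicits.
Arguments demazure_coef22 : clear implicits.

Lemma swap_poly1 i : swap_poly i 1 = 1.
Proof.
apply/malgP => u; rewrite mcoeff_swap !mcoeff1 (_ : (swap_mon i u == mone) = (u == mone)) //.
apply/cmP/cmP => h x; first by rewrite -[u](@swap_monK i) swap_monE h !cm1.
by rewrite swap_monE h !cm1.
Qed.

Lemma demazure1D i f : demazure i (1 + f) = 1 + demazure i f.
Proof.
apply/esym/demazure_uniq; rewrite mulrDr demazureE swap_polyD swap_poly1.
by move: (swap_poly i f) (xvar i) (xvar i.+1) => x y z; ring.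
Qed.

(** * Pairs of factors and the degree two part of a product *)

Fixpoint npairs (s : seq {cmonom xt}) u : nat :=
  if s is v :: s' then (npairs s' u + count (fun v' => mmul v v' == u) s')%N else 0.

Lemma npairs_eq0 s u : uniq s ->
  (forall v v', v \in s -> v' \in s -> v != v' -> mmul v v' != u) -> npairs s u = 0%N.
Proof.
elim: s => //= v s IH /andP [vs us] h; rewrite IH //; last first.
  by move=> x y xs ys; apply: h; rewrite inE ?xs ?ys orbT.
apply/eqP; rewrite eqn0Ngt -has_count; apply/hasP => -[v' v's /eqP E].
have /eqP [] // : mmul v v' != u; apply: h; rewrite ?inE ?eqxx ?v's ?orbT //.
by apply: contraNneq vs => ->.
Qed.

(** By cancellation each of [v1], [v2] has the other as its only partner, so the pair is counted
    once, at whichever of the two comes first in [s]. *)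
Lemma npairs_unique s u v1 v2 : uniq s -> v1 != v2 -> mmul v1 v2 = u ->
  (forall v v', v \in s -> v' \in s -> v != v' -> mmul v v' = u -> v \in [:: v1; v2]) ->
  npairs s u = ((v1 \in s) && (v2 \in s) : nat).
Proof.
move=> + v12 v12u; elim: s => //= v s IH /andP [vs us] h.
have vc : count (fun v' => mmul v v' == u) s =
    ((v == v1) && (v2 \in s) || (v == v2) && (v1 \in s)).
  have c1 x y : mmul x y = u -> count (fun v' => mmul x v' == u) s = (y \in s).
    move=> <-; rewrite -(count_uniq_mem y us); apply: eq_count => v' /=.
    by apply/eqP/eqP => [/mmulI|->].
  case: (eqVneq v v1) => [->|n1]; first by rewrite (c1 _ _ v12u) (negbTE v12) orbF.
  case: (eqVneq v v2) => [->|n2] /=; first by rewrite (c1 _ v1) // mulmC.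
  apply/eqP; rewrite -[eqbRHS]/0%N eqn0Ngt -has_count; apply/hasP => -[v' v's /eqP E].
  have : v \in [:: v1; v2].
    apply: (h v v'); rewrite ?inE ?eqxx ?v's ?orbT //.
    by apply: contraNneq vs => ->.
  by rewrite !inE (negbTE n1) (negbTE n2).
rewrite vc IH // => [|x y xs ys]; last by apply: h; rewrite inE ?xs ?ys orbT.
rewrite !inE ![_ == v]eq_sym; move: vs v12.
case: (eqVneq v v1) => [<-|_] /=; case: (eqVneq v v2) => [<-|_] //=; rewrite ?eqxx //.
- by move=> /negbTE -> _; rewrite /= orbF.
- by move=> /negbTE -> _; rewrite andbF andbT.
- by move=> _ _; rewrite addn0.
Qed.

(* The exponent of [t_1] is the degree in the [T_l]. *)
Definition tdeg u : nat := u (inr 0%N).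

Definition tdeg_le1 p :=
  (forall u, tdeg u = 0%N -> p@_u = (u == mone)%:R) /\ (forall u, tdeg u = 1%N -> p@_u = 0).

Lemma tdegM u v : tdeg (mmul u v) = (tdeg u + tdeg v)%N.
Proof. exact: cmM. Qed.

(** Multiplying q by 1 - v subtracts the coefficient of u/v from that of u, so each degree uses the
    one below it and the three clauses are proved together. As [p] has no term of degree one, no
    cross term between [p] and the factors enters in degree two. *)
Lemma mcoeff_mulprod p s : tdeg_le1 p -> (forall v, v \in s -> tdeg v = 1%N) ->
  let q := p * \prod_(v <- s) (1 - mon v) in
  [/\ forall u, tdeg u = 0%N -> q@_u = (u == mone)%:R,
      forall u, tdeg u = 1%N -> q@_u = - (count_mem u s)%:R &
      forall u, tdeg u = 2%N -> q@_u = p@_u + (npairs s u)%:R].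
Proof.
move=> [p0 p1] /=; elim: s => [|v s IH] ds; rewrite ?big_nil ?big_cons.
  rewrite mulr1; split=> u du /=; first exact: p0.
    by rewrite p1 ?oppr0.
  by rewrite addr0.
have {IH} [|q0 q1 q2] := IH; first by move=> x xs; apply: ds; rewrite inE xs orbT.
rewrite mulrCA mulrBl mul1r; move: (p * _) q0 q1 q2 => q q0 q1 q2.
have dv : tdeg v = 1%N by apply: ds; rewrite inE eqxx.
(* Either [v] divides [u], with the exponentwise difference as quotient, or some variable in the
   support of [v] obstructs it. *)
have vq u : (exists u', u = mmul v u') \/ forall u', mmul v u' != u.
  case: (boolP [forall x : finsupp v, v (val x) <= u (val x)]%N) => [/forallP le|].
    left; exists [cmonom (u x - v x)%N | x in finsupp u]%M; apply: cmonomP => x.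
    rewrite cmM cmE fsfun_fun; case: ifPn => [_|].
      rewrite subnKC //; case: (boolP (x \in finsupp v)) => xv; last first.
        by move: xv; rewrite -cmE_eq0 => /eqP ->.
      exact: (le [` xv]).
    rewrite -cmE_eq0 => /eqP ux; case: (boolP (x \in finsupp v)) => xv.
      by have := le [` xv]; rewrite /= ux; case: (v x).
    by move: xv; rewrite -cmE_eq0 ux => /eqP ->.
  rewrite negb_forall => /existsP [x xv]; right => u'; apply: contraNneq xv => <-.
  by rewrite cmM leq_addr.
split=> u du; rewrite mcoeffB; case: (vq u) => [[u' E]|nd].
- by move: du; rewrite E tdegM dv.
- by rewrite q0 // mcoeff_monM0 // subr0.
- have du' : tdeg u' = 0%N by move: du; rewrite E tdegM dv; lia.
  rewrite E mcoeff_monMl (q0 u') // q1 -?E //= natrD.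
  suff -> : (v == u) = (u' == mone) by ring.
  by rewrite E; apply/eqP/eqP => [|->]; rewrite ?mulm1 // -{1}[v]mulm1 => /mmulI.
- rewrite q1 // mcoeff_monM0 //= (_ : (v == u) = false) ?add0n ?subr0 //.
  by apply/negbTE; rewrite -[v]mulm1.
- have du' : tdeg u' = 1%N by move: du; rewrite E tdegM dv; lia.
  rewrite E mcoeff_monMl (q1 u') // q2 -?E //= natrD opprK addrA; congr (_ + _%:R).
  by apply: eq_count => x /=; rewrite E; apply/eqP/eqP => [->|/mmulI].
- rewrite q2 // mcoeff_monM0 //= subr0 (_ : count _ s = 0%N) ?addn0 //.
  by apply/eqP; rewrite eqn0Ngt -has_count; apply/hasP => -[x _]; apply/negP.
Qed.

(** * Counting criterion for A_l(w), and its behaviour under s_i *)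

Local Open Scope nat_scope.

Definition cnt A (m : nat) : nat := count (fun a => a < m) A.

Lemma cnt0 A : cnt A 0 = 0.
Proof. by rewrite /cnt (eq_count (a2 := pred0)) ?count_pred0. Qed.

Lemma cntS A m : cnt A m.+1 = cnt A m + (m \in A).
Proof.
rewrite /cnt -(count_uniq_mem m (fset_uniq A)) -count_predUI.
rewrite [X in _ = _ + X](eq_count (a2 := pred0)) ?count_pred0 ?addn0 => [|a /=].
  by apply: eq_count => a /=; rewrite ltnS leq_eqVlt orbC.
by case: eqP => [->|]; rewrite ?ltnn ?andbF.
Qed.

Lemma cnt_large A : exists M, forall m, M <= m -> cnt A m = #|` A|.
Proof.
exists (\max_(a <- A) a.+1) => m le; apply/eqP; rewrite -all_count.
apply/allP => a aA; apply: leq_trans le.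
by apply: (leq_bigmax_seq (F := succn)) aA _.
Qed.

Lemma sorted_nth_lt s m j : sorted leq s -> j < size s ->
  (nth 0 s j < m) = (j < count (fun a => a < m) s).
Proof.
elim: s j => //= x s IH j xs js; case: (ltnP x m) => xm.
  by case: j js => [|j] js; rewrite /= ?xm // IH // (path_sorted xs).
rewrite add0n; have /allP ge := order_path_min leq_trans xs.
have -> : count (fun a => a < m) s = 0.
  apply/eqP; rewrite eqn0Ngt -has_count; apply/hasPn => a /ge.
  by rewrite -leqNgt; apply: leq_trans.
rewrite ltn0; apply/negbTE; rewrite -leqNgt.
by case: j js => //= j js; apply: leq_trans xm (ge _ _); rewrite mem_nth.
Qed.

(** In a sorted sequence, entry j is below m exactly when more than j entries are ([sorted_nth_lt]),
    so entrywise comparison becomes reversed comparison of the counting functions. *)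
Lemma sorted_nth_leP s t : sorted leq s -> sorted leq t -> size s = size t ->
  (forall j, j < size t -> nth 0 s j <= nth 0 t j) <->
  (forall m, count (fun a => a < m) t <= count (fun a => a < m) s).
Proof.
move=> ss st sz; split=> h.
  move=> m; case E: (count _ t) => [//|c].
  have ct : c < count (fun a => a < m) t by rewrite E.
  have cs := leq_trans ct (count_size _ _).
  rewrite -sorted_nth_lt ?sz //; apply: leq_ltn_trans (h _ cs) _.
  by rewrite sorted_nth_lt.
move=> j jt; rewrite -ltnS sorted_nth_lt ?sz //; apply: leq_trans (h _).
by rewrite -sorted_nth_lt.
Qed.

Definition wset (l : nat) w : {fset nat} := [fset w j | j in iota 0 l].

Lemma mem_wset l w x : reflect (exists2 j, j < l & w j = x) (x \in wset l w).
Proof.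
apply: (iffP idP) => [/imfsetP [j /= + ->]|[j jl <-]].
  by rewrite mem_iota => jl; exists j.
by apply/imfsetP; exists j; rewrite //= mem_iota.
Qed.

Lemma perm_wset l w : injective w -> perm_eq (wset l w) [seq w j | j <- iota 0 l].
Proof.
move=> wI; apply: uniq_perm; rewrite ?fset_uniq ?map_inj_uniq ?iota_uniq // => x.
apply/mem_wset/mapP => -[j]; first by move=> jl <-; exists j; rewrite ?mem_iota.
by rewrite mem_iota => jl ->; exists j.
Qed.

(** Counts do not see the order of the entries, so the sorted prefix of [w] can be replaced by the
    set [wset l w]. *)
Lemma in_AP l w A : injective w ->
  reflect (#|` A| = l /\ forall m, cnt (wset l w) m <= cnt A m) (in_A l w A).
Proof.
move=> wI; rewrite /in_A; case: (eqVneq #|` A| l) => [cA|/eqP ne]; last first.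
  by constructor; case.
have cw m : cnt (wset l w) m = count (fun a => a < m) (wsort l w).
  by apply/permP; rewrite perm_sym /wsort perm_sort perm_sym perm_wset.
have ca m : cnt A m = count (fun a => a < m) (sort leq A).
  by apply/permP; rewrite perm_sym perm_sort.
have [h1 h2] := @sorted_nth_leP (sort leq A) (wsort l w) (sort_sorted leq_total _)
  (sort_sorted leq_total _) (etrans (size_sort _ _) (etrans cA
   (esym (etrans (size_sort _ _) (etrans (size_map _ _) (size_iota _ _)))))).
rewrite /wsort size_sort size_map size_iota -/(wsort l w) in h1 h2.
apply: (iffP forallP) => /= h.
  split=> // m; rewrite cw ca; apply: h1 => j jl; exact: (h (Ordinal jl)).
by move=> j; apply: h2 => // m; rewrite -cw -ca; case: h.
Qed.

Lemma card_in_A l w A : in_A l w A -> #|` A| = l.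
Proof. by case/andP => /eqP. Qed.

Lemma mem_sact i A j : (j \in sact i A) = (simple i j \in A).
Proof.
apply/imfsetP/idP => [[x /= xA ->]|]; first by rewrite simpleK.
by exists (simple i j); rewrite ?simpleK.
Qed.

Lemma sactK i : involutive (sact i).
Proof. by move=> A; apply/fsetP => j; rewrite !mem_sact simpleK. Qed.

Lemma simpleL i : simple i i = i.+1.
Proof. by rewrite simpleE eqxx. Qed.

Lemma simpleR i : simple i i.+1 = i.
Proof. by rewrite -[X in simple i X](simpleL i) simpleK. Qed.

Lemma simpleD i j : j != i -> j != i.+1 -> simple i j = j.
Proof. by rewrite simpleE => /negbTE -> /negbTE ->. Qed.

Lemma card_sact i A : #|` sact i A| = #|` A|.
Proof. by rewrite card_imfset //; apply: simple_inj. Qed.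

(** The threshold i+1 is the only one that separates i from i+1. *)
Lemma cnt_sact i A m :
  cnt (sact i A) m = if m == i.+1 then cnt A i + (i.+1 \in A) else cnt A m.
Proof.
have le n : n <= i -> cnt (sact i A) n = cnt A n.
  elim: n => [|n IH] ni; first by rewrite !cnt0.
  by rewrite !cntS IH ?mem_sact ?simpleD //; lia.
have E1 : cnt (sact i A) i.+1 = cnt A i + (i.+1 \in A).
  by rewrite cntS le // mem_sact simpleL.
case: eqP => [->//|/eqP mi]; case: (leqP m i) => im; first exact: le.
have -> : m = i.+2 + (m - i.+2) by lia.
elim: (m - _) => [|n IH]; first by rewrite addn0 cntS E1 mem_sact simpleR !cntS addnAC.
by rewrite addnS (cntS _ (i.+2 + n)) (cntS A (i.+2 + n)) IH mem_sact simpleD //; lia.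
Qed.

Lemma eqnS i : (i == i.+1) = false.
Proof. exact/eqP/n_Sn. Qed.

Lemma eqSn i : (i.+1 == i) = false.
Proof. by rewrite eq_sym eqnS. Qed.

Section Covering.
Variables (i : nat) (w : {fsfun nat -> nat}).
Hypotheses (wI : injective w) (up : perm_len w < perm_len (fsfun_comp (simple i) w)).
Let w' := fsfun_comp (simple i) w.

Lemma comp_simple_inj : injective w'.
Proof. by apply: fscomp_inj => //; apply: simple_inj. Qed.

Lemma wset_comp l : wset l w' = sact i (wset l w).
Proof.
apply/fsetP => x; rewrite mem_sact; apply/mem_wset/mem_wset => -[j jl E]; exists j => //.
  by rewrite -E fscompE /= simpleK.
by rewrite fscompE /= E simpleK.
Qed.

(** Since s_i increases the length, i stands before i+1 in the one-line notation of [w]; otherwise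
    s_i w would be shorter by [len_simple]. *)
Lemma wset_up l : i.+1 \in wset l w -> i \in wset l w.
Proof.
case/mem_wset => a al wa; have [b wb] := fsinj_surj i wI.
apply/mem_wset; exists b => //; apply: leq_trans al; rewrite ltnS leqNgt.
by apply/negP => ab; have := len_simple wI ab wa wb; lia.
Qed.

Lemma wset_sub l k : k <= l -> {subset wset k w <= wset l w}.
Proof. by move=> kl x /mem_wset [j jk E]; apply/mem_wset; exists j; first exact: leq_trans jk kl. Qed.

(** Passing from w to s_i w changes only the inequality at threshold i+1. *)
Let gale_comp l A : (forall m, cnt (wset l w') m <= cnt A m) <->
  (forall m, m != i.+1 -> cnt (wset l w) m <= cnt A m) /\
  cnt (wset l w) i + (i.+1 \in wset l w) <= cnt A i + (i \in A).
Proof.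
split=> [h|[h1 h2] m].
  split=> [m /negbTE mi|]; first by have := h m; rewrite wset_comp cnt_sact mi.
  by have := h i.+1; rewrite wset_comp cnt_sact eqxx cntS.
by rewrite wset_comp cnt_sact; case: (eqVneq m i.+1) => [->|/h1 //]; rewrite cntS.
Qed.

(** Only threshold i+1 needs checking. If i+1 is not in the prefix of [w], threshold i suffices; if
    it is, so is i, and thresholds i and i+2 together suffice. *)
Lemma in_A_comp_sact l A : in_A l w' (sact i A) = in_A l w' A.
Proof.
suff W B : in_A l w' B -> in_A l w' (sact i B) by apply/idP/idP => /W //; rewrite sactK.
move=> /(in_AP _ _ comp_simple_inj) [cB /gale_comp [h1 h2]].
apply/(in_AP _ _ comp_simple_inj); rewrite card_sact; split=> //; apply/gale_comp.
split=> [m mi|]; first by rewrite cnt_sact (negbTE mi) h1.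
have := h1 i; have := h1 i.+2; rewrite !cntS cnt_sact mem_sact simpleL eqSS eqSn eqnS.
move=> /(_ isT) + /(_ isT); move: h2 {h1}; have := @wset_up l.
case: (i.+1 \in wset l w); case: (i \in wset l w) => /= up'; try (by have := up' isT);
  by case: (i \in B); case: (i.+1 \in B); lia.
Qed.

Lemma in_A_comp l A : in_A l w A -> in_A l w' A.
Proof.
move=> /(in_AP _ _ wI) [cA h]; apply/(in_AP _ _ comp_simple_inj); split=> // m.
apply: leq_trans (h m); rewrite wset_comp cnt_sact; case: eqP => // ->.
by rewrite cntS leq_add2l; have := @wset_up l; case: (_ \in _) => // ->.
Qed.

(** The inequality that [w] requires at i+1 follows from the one at i if i is in [A], and from the
    one at i+2 if neither i nor i+1 is. *)
Lemma in_A_low l A : (i.+1 \in A -> i \in A) -> in_A l w' A = in_A l w A.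
Proof.
move=> low; apply/idP/idP; last exact: in_A_comp.
move=> /(in_AP _ _ comp_simple_inj) [cA /gale_comp [h1 h2]].
apply/(in_AP _ _ wI); split=> // m; case: (eqVneq m i.+1) => [->|/h1 //].
have := h1 i; have := h1 i.+2; rewrite !cntS eqSS eqSn eqnS.
move=> /(_ isT) + /(_ isT); move: low h2 {h1}; have := @wset_up l.
case: (i.+1 \in A) => [_ /(_ isT) ->|_ _]; case: (i \in A); case: (i.+1 \in wset l w) => //;
  by case: (i \in wset l w) => //; lia.
Qed.

Definition newA l A := in_A l w' A && ~~ in_A l w A.

Lemma newA_mem l A : newA l A -> (i.+1 \in A) && (i \notin A).
Proof.
case/andP => h /negP n; case: (boolP (i.+1 \in A)) => /= i1; last first.
  by case: n; rewrite -in_A_low // (negbTE i1).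
by apply/negP => iA; case: n; rewrite -in_A_low.
Qed.

(** Links the two descriptions of the factors of N_{w,i}: the sets gained on passing to s_i w are
    the s_i alpha with alpha in A_{l,i}(w). *)
Lemma newAE l A : newA l A = in_A l w (sact i A) && ~~ in_A l w A.
Proof.
apply/idP/idP => [nA|/andP [h n]]; last first.
  by rewrite /newA n andbT -in_A_comp_sact in_A_comp.
have /andP [_ iA] := newA_mem nA; case/andP: nA => h ->; rewrite andbT.
by rewrite -in_A_low ?in_A_comp_sact // !mem_sact simpleR simpleL (negbTE iA).
Qed.

End Covering.

(** * Degree two coefficients along the recursion *)

Lemma cm_big (I : Type) (r : seq I) (F : I -> {cmonom xt}) x :
  (\big[mmul/mone]_(j <- r) F j) x = \sum_(j <- r) F j x.
Proof. exact: (big_morph (fun m : {cmonom xt} => m x) (cmM x) (cm1 x)). Qed.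

Lemma xmon_inl s j : xmon s (inl j) = count_mem j s.
Proof.
rewrite cm_big -sum1_count [RHS]big_mkcond; apply: eq_bigr => a _ /=.
by rewrite cmU (inj_eq inl_inj); case: eqP.
Qed.

Lemma xmon_inr s j : xmon s (inr j) = 0.
Proof. by rewrite cm_big big1 // => a _; rewrite cmU. Qed.

Lemma Tmon_inl l j : Tmon l (inl j) = 0.
Proof. by rewrite cm_big big1 // => a _; rewrite cmU. Qed.

Lemma Tmon_inr l j : Tmon l (inr j) = (j < l).
Proof.
rewrite cm_big -[j < l](mem_iota 0) -{2}[l]subn0 -/(index_iota 0 l).
rewrite -(count_uniq_mem j (iota_uniq _ _)) -sum1_count [RHS]big_mkcond.
by apply: eq_bigr => a _ /=; rewrite cmU (inj_eq inr_inj); case: eqP.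
Qed.

Definition xT A l : {cmonom xt} := mmul (xmon A) (Tmon l).

Lemma xT_inl A l j : xT A l (inl j) = (j \in A).
Proof. by rewrite cmM xmon_inl Tmon_inl addn0 count_uniq_mem ?fset_uniq. Qed.

Lemma xT_inr A l j : xT A l (inr j) = (j < l).
Proof. by rewrite cmM xmon_inr Tmon_inr. Qed.

Lemma xT_inj A B a b : xT A a = xT B b -> A = B /\ a = b.
Proof.
move=> E; have e x : xT A a x = xT B b x by rewrite E.
split; first by apply/fsetP => j; have := e (inl j); rewrite !xT_inl; do 2!case: (_ \in _).
by have := e (inr a); have := e (inr b); rewrite !xT_inr; lia.
Qed.

Definition Nfactors w i : seq {cmonom xt} :=
  [seq xT (sact i A) l | l <- index_iota 1 (maxn (supp_bound w) i.+2), A <- Aiset l i w].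

Lemma NprodE w i : Nprod w i = (\prod_(v <- Nfactors w i) (1 - mon v))%R.
Proof. by rewrite /Nprod /Nfactors big_allpairs_dep. Qed.

Lemma Nfactors_uniq w i : uniq (Nfactors w i).
Proof.
apply: allpairs_uniq_dep => [|l _|]; rewrite ?iota_uniq ?fset_uniq //.
move=> [l A] [l' A'] _ _ /xT_inj /= [E ->].
by rewrite -(sactK i A) E sactK.
Qed.

(** The t-part of [u] is T_k T_l: with shifted labels, t_j divides T_k exactly when j < k. *)
Definition has_T u k l := forall j, u (inr j) = (j < k) + (j < l).

Definition splits u A B := forall j, u (inl j) = (j \in A) + (j \in B).

Lemma mul_xT u A B a b k l : k <= l -> has_T u k l ->
  mmul (xT A a) (xT B b) = u ->
  splits u A B /\ ((a = k /\ b = l) \/ (a = l /\ b = k)).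
Proof.
move=> kl uT E; have e x : xT A a x + xT B b x = u x by rewrite -E cmM.
split=> [j|]; first by rewrite -e !xT_inl.
have h j : (j < a) + (j < b) = (j < k) + (j < l) by rewrite -uT -e !xT_inr.
(* Testing the thresholds a, b, k, l is enough to recover the unordered pair. *)
by have := h a; have := h b; have := h k; have := h l; lia.
Qed.

Section Covering.
Variables (i : nat) (w : {fsfun nat -> nat}).
Hypotheses (wI : injective w) (up : perm_len w < perm_len (fsfun_comp (simple i) w)).

Lemma mem_Nfactors v :
  reflect (exists l A, [/\ 0 < l, newA i w l A & v = xT A l]) (v \in Nfactors w i).
Proof.
apply: (iffP allpairsPdep) => [[l [A]]|[l [A []]]].
  rewrite mem_index_iota mem_Aiset => -[/andP [l0 _] /andP [h1 h2] ->].
  by exists l, (sact i A); rewrite newAE // sactK h1.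
move=> l0; rewrite newAE // => /andP [h1 h2] ->; exists l, (sact i A).
have mA : sact i A \in Aiset l i w by rewrite mem_Aiset h1 sactK.
rewrite mA sactK; split=> //; rewrite mem_index_iota l0 ltnNge.
(* The truncated range of [l] loses nothing: beyond it [Aiset l i w] is empty. *)
by apply/negP => /(Aiset_eq0 wI) E; rewrite E in_fset0 in mA.
Qed.

Lemma tdeg_Nfactors v : v \in Nfactors w i -> tdeg v = 1.
Proof. by case/mem_Nfactors => l [A [l0 _ ->]]; rewrite /tdeg xT_inr l0. Qed.

Lemma Nfactors_exp v : v \in Nfactors w i -> v (inl i) = 0 /\ v (inl i.+1) = 1.
Proof.
by case/mem_Nfactors => l [A [_ /(newA_mem wI up) /andP [i1 i0] ->]]; rewrite !xT_inl i1 (negbTE i0).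
Qed.

Lemma Nfactors_le1 v j : v \in Nfactors w i -> v (inl j) <= 1.
Proof. by case/mem_Nfactors => l [A [_ _ ->]]; rewrite xT_inl; case: (_ \in _). Qed.

(** Each factor contains x_(i+1) once and not x_i, so a product of two has exponents (0, 2)
    there. *)
Lemma npairs_Nfactors_low u : (u (inl i), u (inl i.+1)) != (0, 2) -> npairs (Nfactors w i) u = 0.
Proof.
move=> ne; apply: npairs_eq0 => [|v v' /Nfactors_exp [a1 a2] /Nfactors_exp [b1 b2] _].
  exact: Nfactors_uniq.
by apply: contraNneq ne => <-; rewrite !cmM a1 a2 b1 b2.
Qed.

Lemma npairs_Nfactors_big u j : 2 < u (inl j) -> npairs (Nfactors w i) u = 0.
Proof.
move=> big; apply: npairs_eq0 => [|v v' /(Nfactors_le1 j) h1 /(Nfactors_le1 j) h2 _].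
  exact: Nfactors_uniq.
by apply: contraTneq big => <-; rewrite cmM; lia.
Qed.

Lemma mem_Nfactors_xT A l : 0 < l -> (xT A l \in Nfactors w i) = newA i w l A.
Proof.
move=> l0; apply/mem_Nfactors/idP => [[l' [A' [_ nA /xT_inj [-> ->]]]] //|nA].
by exists l, A.
Qed.

(** For the vanishing range: when k = l the two distinct factors would have to be equal, and when k
    < l the sizes leave no splitting. *)
Lemma npairs_Nfactors_none u k l : k <= l -> has_T u k l ->
  (forall A B, #|` A| = k -> #|` B| = l -> splits u A B -> k = l -> A = B) ->
  (forall A B, #|` A| = k -> #|` B| = l -> splits u A B -> k < l -> False) ->
  npairs (Nfactors w i) u = 0.
Proof.
move=> kl uT h1 h2; apply: npairs_eq0; first exact: Nfactors_uniq.
move=> v v' /mem_Nfactors [a [A [_ /andP [/card_in_A cA _] ->]]].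
move=> /mem_Nfactors [b [B [_ /andP [/card_in_A cB _] ->]]] /eqP ne; apply/eqP.
move=> /(mul_xT kl uT) [s]; have s' : splits u B A by move=> j; rewrite s addnC.
move: kl; rewrite leq_eqVlt => /predU1P [kl|kl] ab.
  by case: ne; rewrite (h1 A B) //; [congr xT|..]; lia.
by case: ab => -[Ea Eb]; subst a b; [apply: (h2 A B) | apply: (h2 B A)].
Qed.

Lemma npairs_Nfactors_one u k l A0 B0 : 0 < k -> k <= l -> has_T u k l ->
  splits u A0 B0 -> (k = l -> A0 <> B0) ->
  (forall A B, #|` A| = k -> #|` B| = l -> splits u A B ->
     (A = A0 /\ B = B0) \/ (k = l /\ A = B0 /\ B = A0)) ->
  npairs (Nfactors w i) u = newA i w k A0 && newA i w l B0.
Proof.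
move=> k0 kl uT s0 ne h.
rewrite -!mem_Nfactors_xT //; last exact: leq_trans k0 kl.
apply: npairs_unique; first exact: Nfactors_uniq.
- by apply/eqP => /xT_inj [? ?]; apply: ne.
- apply: cmonomP => -[j|j]; rewrite cmM; last by rewrite !xT_inr uT.
  by rewrite !xT_inl s0.
move=> v v' /mem_Nfactors [a [A [_ /andP [/card_in_A cA _] ->]]].
move=> /mem_Nfactors [b [B [_ /andP [/card_in_A cB _] ->]]] _.
move=> /(mul_xT kl uT) [s]; have s' : splits u B A by move=> j; rewrite s addnC.
rewrite !inE; case=> -[Ea Eb]; rewrite {}Ea {}Eb in cA cB *.
  by case: (h A B cA cB s) => [[-> _]|[<- [-> _]]]; rewrite eqxx ?orbT.
by case: (h B A cB cA s') => [[_ ->]|[<- [_ ->]]]; rewrite eqxx ?orbT.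
Qed.

Local Open Scope ring_scope.

Variable p : poly_xt.
Hypothesis p1 : tdeg_le1 p.
Let p' := demazure i (p * Nprod w i).

Let tdeg_setx u a b : tdeg (setx i u a b) = tdeg u.
Proof. exact: setx_inr. Qed.

Let FE : [/\ forall u, tdeg u = 0%N -> (p * Nprod w i)@_u = (u == mone)%:R,
      forall u, tdeg u = 1%N -> (p * Nprod w i)@_u = - (count_mem u (Nfactors w i))%:R &
      forall u, tdeg u = 2%N -> (p * Nprod w i)@_u = p@_u + (npairs (Nfactors w i) u)%:R].
Proof. by rewrite NprodE; apply: (mcoeff_mulprod p1 tdeg_Nfactors). Qed.

(** In degree one, P_w N_{w,i} only has monomials with exponents (0, 1) at i and i+1, and pi_i kills
    these. *)
Lemma tdeg_le1_demazure : tdeg_le1 p'.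
Proof.
rewrite /p'; move: (p * Nprod w i) FE => f [f0 f1 _]; split=> u du.
  have -> : f = 1 + (f - 1) by rewrite addrC subrK.
  rewrite demazure1D mcoeffD mcoeff1.
  suff -> : (demazure i (f - 1))@_u = 0 by rewrite addr0.
  rewrite -(setx_id i u); apply: demazure_coef_eq0 => c d _ _.
  by rewrite mcoeffB mcoeff1 f0 ?tdeg_setx // subrr.
have fz c d : (c, d) != (0, 1)%N -> f@_(setx i u c d) = 0.
  move=> ne; rewrite f1 ?tdeg_setx //; apply/eqP; rewrite oppr_eq0.
  rewrite (_ : count_mem _ _ = 0%N) //; apply/count_memPn/negP => /Nfactors_exp.
  by rewrite setxl setxr => -[E1 E2]; move: ne; rewrite E1 E2 eqxx.
rewrite -(setx_id i u); case: (eqVneq (u (inl i) + u (inl i.+1))%N 1%N) => E; last first.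
  by apply: demazure_coef_eq0 => c d E' _; apply: fz; apply: contra_neq E; rewrite -E' => -[-> ->].
have [[-> ->]|[-> ->]] : (u (inl i) = 1 /\ u (inl i.+1) = 0 \/ u (inl i) = 0 /\ u (inl i.+1) = 1)%N.
- by move: E; lia.
- by rewrite demazure_coef0 fz.
- by rewrite demazure_coefC demazure_coef0 fz.
Qed.

Lemma mcoeff_demazure_swap u : p'@_(swap_mon i u) = p'@_u.
Proof.
have := demazure_coefC i (p * Nprod w i) u (u (inl i)) (u (inl i.+1)).
by rewrite setx_id -swap_setx setx_id.
Qed.

Hypothesis p3 : forall u j, tdeg u = 2%N -> (2 < u (inl j))%N -> p@_u = 0.

Let F3 u j : tdeg u = 2%N -> (2 < u (inl j))%N -> (p * Nprod w i)@_u = 0.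
Proof. by move=> du uj; case: FE => _ _ ->; rewrite // (p3 du uj) (npairs_Nfactors_big uj) addr0. Qed.

Lemma mcoeff_demazure_big u j : tdeg u = 2%N -> (2 < u (inl j))%N -> p'@_u = 0.
Proof.
move=> du uj; rewrite -(setx_id i u); apply: demazure_coef_eq0 => c d _ le.
case: (boolP ((j == i) || (j == i.+1))) => [ji|]; last first.
  by rewrite negb_or => /andP [j1 j2]; apply: (F3 (j := j)); rewrite ?tdeg_setx ?setxo.
have cd : (2 < maxn c d)%N.
  by apply: leq_trans le; rewrite leq_max; case/orP: ji => /eqP <-; rewrite uj ?orbT.
case: (leqP c 2) => c2; last by apply: (F3 (j := i)); rewrite ?tdeg_setx ?setxl.
by apply: (F3 (j := i.+1)); rewrite ?tdeg_setx ?setxr; lia.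
Qed.

(** The exponents at i and i+1 are (a, 0), (2, 1) or (2, 2). There pi_i adds nothing, or only
    coefficients with an exponent above 2, which vanish; and [npairs] is zero off (0, 2). *)
Lemma mcoeff_demazure_low u : tdeg u = 2%N ->
  (u (inl i.+1) = 0 \/ u (inl i) = 2)%N -> (u (inl i) <= 2)%N -> (u (inl i.+1) <= 2)%N ->
  p'@_u = p@_u.
Proof.
move=> du low le1 le2.
have E : (p * Nprod w i)@_u = p@_u.
  case: FE => _ _ ->; rewrite // npairs_Nfactors_low ?addr0 //.
  by apply/eqP => -[E1 E2]; move: low; rewrite E1 E2; case.
have F3l c d : (2 < c)%N -> (p * Nprod w i)@_(setx i u c d) = 0.
  by move=> ?; apply: (F3 (j := i)); rewrite ?tdeg_setx ?setxl.
have F3r c d : (2 < d)%N -> (p * Nprod w i)@_(setx i u c d) = 0.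
  by move=> ?; apply: (F3 (j := i.+1)); rewrite ?tdeg_setx ?setxr.
rewrite -[in RHS]E /p' -(setx_id i u).
case: low => [->|E1]; first exact: demazure_coef0.
rewrite E1; case: (u (inl i.+1)) le2 => [|[|[|//]]] _; first exact: demazure_coef0.
  by rewrite demazure_coef21 (F3l 3 0)%N ?(F3r 0 3)%N // subr0 addr0.
by rewrite demazure_coef22 (F3l 3 1)%N ?(F3l 4 0)%N ?(F3r 1 3)%N ?(F3r 0 4)%N // !subr0 ?addr0.
Qed.

(** By [demazure_coef11] the exponents (1, 1), (2, 0) and (0, 2) contribute; of these only (0, 2)
    can come from a pair of factors. *)
Lemma mcoeff_demazure_mid u : tdeg u = 2%N -> u (inl i) = 1%N -> u (inl i.+1) = 1%N ->
  p'@_u = p@_u + p@_(setx i u 2 0) - p@_(setx i u 0 2) - (npairs (Nfactors w i) (setx i u 0 2))%:R.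
Proof.
move=> du E1 E2; rewrite -{1}(setx_id i u) E1 E2 /p' demazure_coef11.
case: FE => _ _ F2; rewrite !F2 ?tdeg_setx //.
have -> : setx i u 1 1 = u by rewrite -[RHS](setx_id i u) E1 E2.
rewrite (@npairs_Nfactors_low u) ?E1 ?E2 //.
by rewrite (@npairs_Nfactors_low (setx i u 2 0)) ?setxl ?setxr //; ring.
Qed.

End Covering.

(** * Splittings of eta for k < l *)

Lemma cntU1 x A m : x \notin A -> cnt (x |` A) m = cnt A m + (x < m).
Proof.
move=> xA; elim: m => [|m IH]; first by rewrite !cnt0.
rewrite !cntS IH !inE ltnS; case: (ltngtP x m) => [||<-]; rewrite ?(negbTE xA) /=; lia.
Qed.

Lemma cntD1 x A m : x \in A -> cnt (A `\ x) m + (x < m) = cnt A m.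
Proof. by move=> xA; rewrite -cntU1 ?fsetD1K // !inE eqxx. Qed.

Lemma cntUd A B m : [disjoint A & B] -> cnt (A `|` B) m = cnt A m + cnt B m.
Proof.
move=> /fdisjointP d; elim: m => [|m IH]; first by rewrite !cnt0.
rewrite !cntS IH inE; case: (boolP (m \in A)) => [/d/negbTE ->|_] /=; lia.
Qed.

Lemma leq_mem A B (x : nat) : {subset A <= B} -> (x \in A) <= (x \in B).
Proof. by move=> s; case: (boolP (x \in A)) => // /s ->. Qed.

(** [E1], [E2] stand for eta_1, eta_2, and [V], [W] for the prefixes of [w] of lengths k and l. The
    two inequality families bound e from above and from below, so the admissible e form an interval
    in [E1]. Here i+1 is admissible and i is blocked on the [W] side; the next element of [E1] after
    i+1 is then admissible. *)
Lemma interlace_up E1 E2 V W i : {subset V <= W} -> i.+1 \in E1 ->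
  (forall m, cnt W m + (i.+1 < m) <= cnt E1 m + cnt E2 m) ->
  (forall m, cnt V m <= cnt E2 m + (i.+1 < m)) ->
  cnt E1 i.+1 + cnt E2 i.+1 <= cnt W i.+1 -> #|` E2| < #|` V| ->
  exists e, [/\ e \in E1, i.+1 < e, forall m, cnt V m <= cnt E2 m + (e < m) &
    forall m, cnt W m + (e < m) <= cnt E1 m + cnt E2 m].
Proof.
move=> VW i1 r q s cV; have step x := leq_mem x VW; have run n : (forall x, i.+1 < x < i.+2 + n -> x \notin E1) ->
    cnt V (i.+2 + n) <= cnt E2 (i.+2 + n).
  (* As [V] is contained in [W], this bound, started from [s], persists as long as no element of
     [E1] is met; together with [r] it gives the claim. *)
  move=> h; suff : cnt E1 (i.+2 + n) + cnt V (i.+2 + n) <= (cnt W (i.+2 + n)).+1.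
    by have := r (i.+2 + n); rewrite (_ : i.+1 < i.+2 + n); lia.
  elim: n h => [|n IH] h.
    rewrite addn0 !(cntS _ i.+1) i1; have := step i.+1; have := q i.+1.
    by rewrite ltnn; lia.
  rewrite addnS !(cntS _ (i.+2 + n)) (negbTE (h (i.+2 + n) _)); last by lia.
  by have := step (i.+2 + n); have := IH (fun x hx => h x ltac:(lia)); lia.
(* Otherwise the run would reach all large thresholds and give #V <= #E2, against [cV]. *)
have ex : exists e, (e \in E1) && (i.+1 < e).
  have [M1 h1] := cnt_large V; have [M2 h2] := cnt_large E2.
  case: (boolP (has (fun e => i.+1 < e) E1)) => [/hasP [e eE ie]|/hasPn no].
    by exists e; rewrite eE.
  have H x : i.+1 < x < i.+2 + (M1 + M2) -> x \notin E1.
    by case/andP => ix _; apply/negP => /no; rewrite ix.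
  by have := run _ H; rewrite h1 ?h2; lia.
case: (ex_minnP ex) => e /andP [eE ie] emin; exists e; split=> // m; last first.
  by have := r m; case: ltnP; case: ltnP; lia.
have := q m; case: (ltnP i.+1 m) => [im _|im]; last by lia.
case: (ltnP e m) => me; first by have := q m; rewrite im.
have := run (m - i.+2) _; rewrite subnKC // addn0; apply=> x /andP [ix xm].
by apply/negP => xE; have := emin x; rewrite xE ix => /(_ isT); lia.
Qed.

(** Mirror image of [interlace_up]: i is admissible and i+1 is blocked on the [V] side, so the last
    element of [E1] before i is admissible. *)
Lemma interlace_down E1 E2 V W i : {subset V <= W} -> i \in E1 -> i \notin E2 ->
  (forall m, cnt V m <= cnt E2 m + (i < m)) ->
  (forall m, cnt W m + (i < m) <= cnt E1 m + cnt E2 m) ->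
  cnt E2 i.+1 < cnt V i.+1 ->
  exists e, [/\ e \in E1, e < i, forall m, cnt V m <= cnt E2 m + (e < m) &
    forall m, cnt W m + (e < m) <= cnt E1 m + cnt E2 m].
Proof.
move=> VW i0 i2 p s q; have step x := leq_mem x VW; have run n : n <= i -> (forall x, i - n <= x < i -> x \notin E1) ->
    cnt W (i - n) < cnt E1 (i - n) + cnt V (i - n).
  elim: n => [|n IH] ni h.
    have := s i.+1; move: q; rewrite subn0 !(cntS _ i) i0 (negbTE i2) ltnSn; have := step i.
    by lia.
  have E : i - n = (i - n.+1).+1 by lia.
  have := IH (ltnW ni) (fun x hx => h x ltac:(lia)); rewrite E !(cntS _ (i - n.+1)).
  by rewrite (negbTE (h (i - n.+1) _)); [have := step (i - n.+1); lia | lia].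
have ex : exists e, (e \in E1) && (e < i).
  case: (boolP (has (fun e => e < i) E1)) => [/hasP [e eE ie]|/hasPn no].
    by exists e; rewrite eE.
  have H x : i - i <= x < i -> x \notin E1.
    by case/andP => _ xi; apply/negP => /no; rewrite xi.
  (* Running down to threshold 0 would give 0 < 0. *)
  by have := run i (leqnn _) H; rewrite subnn !cnt0.
case: (ex_maxnP ex (m := i)) => [e /andP [_ /ltnW] //|e /andP [eE ie] emax].
exists e; split=> // m; first by have := p m; case: ltnP; case: ltnP; lia.
have := s m; case: (ltnP i m) => [im|im]; first by case: ltnP; lia.
case: (ltnP e m) => me; last by lia.
have := run (i - m) (leq_subr _ _) _; have := p m; rewrite subKn // ltnNge im addn0 addn1.
move=> pm H _; apply: leq_trans (H _) _; last by rewrite leq_add2l.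
move=> x /andP [mx xi]; apply/negP => xE.
by have := emax x; rewrite xE xi => /(_ isT); lia.
Qed.

Definition exps_of u (E1 E2 : {fset nat}) := forall j, u (inl j) = (j \in E1) + 2 * (j \in E2).

(** The condition that eta lies in B_{k,l}(w), stated for the x-exponents of a monomial. *)
Definition two_splits k l w u := exists A A' B B' : {fset nat},
  [/\ in_A l w A, in_A l w A', in_A k w B & in_A k w B'] /\
  [/\ splits u A B, splits u A' B' & [/\ A != A', A != B', B != A' & B != B']].

Lemma splits_inj u A B B' : splits u A B -> splits u A B' -> B = B'.
Proof.
move=> h h'; apply/fsetP => j; have := h' j; rewrite (h j).
by case: (j \in A); case: (j \in B); case: (j \in B').
Qed.

Lemma splitsC u A B : splits u A B -> splits u B A.
Proof. by move=> s j; rewrite s addnC. Qed.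

Lemma splits_exps_of u E1 E2 A B : exps_of u E1 E2 -> splits u A B ->
  E2 `<=` A /\ A `<=` E1 `|` E2.
Proof.
move=> h s; split; apply/fsubsetP => j; have := h j; rewrite s ?inE;
  by case: (j \in A); case: (j \in B); case: (j \in E1); case: (j \in E2).
Qed.

Lemma fsubset_card1 E A : E `<=` A -> #|` A| = #|` E|.+1 -> exists2 x, x \notin E & A = x |` E.
Proof.
move=> s c; have : #|` A `\` E| == 1 by rewrite cardfsDS // c subSnn.
case/cardfs1P => x Ex; have : x \in A `\` E by rewrite Ex inE.
rewrite inE => /andP [xE xA]; exists x => //.
apply/fsetP => j; have /fsetP/(_ j) := Ex; rewrite !inE => <-.
by case: (boolP (j \in E)) => [/(fsubsetP s) ->|]; rewrite ?orbF.
Qed.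

Lemma fsubset_card0 E A : E `<=` A -> #|` A| <= #|` E| -> A = E.
Proof. by move=> s c; apply/eqP; rewrite eq_sym eqEfcard s. Qed.

Section Step.
Variables (i : nat) (w : {fsfun nat -> nat}).
Hypotheses (wI : injective w) (up : perm_len w < perm_len (fsfun_comp (simple i) w)).
Let w' := fsfun_comp (simple i) w.

(** The exponents force each part that contains i+1 to contain i, so [in_A_low] applies to all four
    sets. *)
Lemma two_splits_low k l u : (u (inl i.+1) = 0 \/ u (inl i) = 2) -> two_splits k l w' u <-> two_splits k l w u.
Proof.
move=> low.
have lowA n A B : splits u A B -> in_A n w' A = in_A n w A.
  move=> s; apply: in_A_low => // i1; move: low; rewrite !s i1.
  by case: (i \in A); case: (i \in B) => // -[].
split=> -[A [A' [B [B' [[hA hA' hB hB'] [s s' d]]]]]]; exists A, A', B, B'; split=> //; split.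
all: move: hA hA' hB hB'.
all: by rewrite ?(lowA _ _ _ s) ?(lowA _ _ _ s') ?(lowA _ _ _ (splitsC s)) ?(lowA _ _ _ (splitsC s')).
Qed.

Lemma two_splits_swap k l u : two_splits k l w' (swap_mon i u) <-> two_splits k l w' u.
Proof.
suff W v : two_splits k l w' v -> two_splits k l w' (swap_mon i v) by split=> [/W|/W //]; rewrite swap_monK.
move=> [A [A' [B [B' [[hA hA' hB hB'] [s s' [d1 d2 d3 d4]]]]]]].
have sw X Y : splits v X Y -> splits (swap_mon i v) (sact i X) (sact i Y).
  by move=> h j; rewrite swap_monE /= h !mem_sact.
exists (sact i A), (sact i A'), (sact i B), (sact i B').
by rewrite !in_A_comp_sact // !(inj_eq (inv_inj (@sactK i))); do !split; auto.
Qed.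

Lemma two_splits_mono k l u : two_splits k l w u -> two_splits k l w' u.
Proof.
move=> [A [A' [B [B' [[hA hA' hB hB'] h]]]]]; exists A, A', B, B'; split=> //.
by split; apply: in_A_comp.
Qed.

End Step.

Definition valid1 k l w (E1 E2 : {fset nat}) b :=
  in_A k w (b |` E2) && in_A l w ((E1 `|` E2) `\ b).

Lemma splits_D1 u E1 E2 b : exps_of u E1 E2 -> [disjoint E1 & E2] -> b \in E1 ->
  splits u ((E1 `|` E2) `\ b) (b |` E2).
Proof.
move=> h /fdisjointP d bE j; rewrite h !inE; case: (eqVneq j b) => [->|_] /=.
  by rewrite bE (negbTE (d _ bE)).
by case: (boolP (j \in E1)) => [/d/negbTE ->|_]; case: (j \in E2).
Qed.

(** Both parts contain eta_2, so the part of size k = |eta_2| + 1 is eta_2 with one element b of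
    eta_1, and b determines the splitting. Since k < l, parts of different sizes never coincide. *)
Lemma two_splits_ltP k l w u E1 E2 : exps_of u E1 E2 -> [disjoint E1 & E2] -> k < l -> k = #|` E2|.+1 ->
  two_splits k l w u <-> exists b b', [/\ b \in E1, b' \in E1, b != b', valid1 k l w E1 E2 b &
    valid1 k l w E1 E2 b'].
Proof.
move=> h d kl ck; split=> [[A [A' [B [B' [[hA hA' hB hB'] [s s' [_ _ _ ne]]]]]]]|].
  have F X Y : splits u X Y -> in_A l w X -> in_A k w Y ->
      exists b, [/\ Y = b |` E2, b \in E1 & valid1 k l w E1 E2 b].
    move=> sp hX hY; have [s1 s2] := splits_exps_of h (splitsC sp).
    have [|b bE Yb] := fsubset_card1 s1; first by rewrite (card_in_A hY).
    have bE1 : b \in E1.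
      by move/fsubsetP/(_ b): s2; rewrite Yb !inE eqxx (negbTE bE) !orbF; apply.
    exists b; split=> //; rewrite /valid1 -Yb hY.
    by rewrite -(splits_inj (splitsC sp) (B' := (E1 `|` E2) `\ b)) // Yb; apply/splitsC/splits_D1.
  have [b [Yb bE vb]] := F _ _ s hA hB; have [b' [Yb' bE' vb']] := F _ _ s' hA' hB'.
  by exists b, b'; split=> //; apply: contraNneq ne => E; rewrite Yb Yb' E.
move=> [b [b' [bE bE' ne /andP [v1 v2] /andP [v1' v2']]]].
exists ((E1 `|` E2) `\ b), ((E1 `|` E2) `\ b'), (b |` E2), (b' |` E2); split=> //.
split; [exact: splits_D1|exact: splits_D1|].
have neC X Y : in_A l w X -> in_A k w Y -> X != Y.
  by move=> /card_in_A cX /card_in_A cY; apply: contraTneq kl => E; rewrite -cX -cY E ltnn.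
have b'2 : b' \notin E2 by move/fdisjointP: d; apply.
split; [|exact: neC v2 v1'|by rewrite eq_sym; exact: neC v2' v1|].
  by apply: contra ne => /eqP/fsetP/(_ b); rewrite !inE eqxx bE /= andbT => /esym/negbFE.
apply: contra ne => /eqP/fsetP/(_ b'); rewrite !inE eqxx /= (negbTE b'2) orbF eq_sym => ->.
by [].
Qed.

(** * Splittings of eta when i and i+1 have multiplicity one *)

Definition pairU (E : {fset nat}) x y : {fset nat} := x |` (y |` E).

Lemma in_pairU E x y j : (j \in pairU E x y) = [|| j == x, j == y | j \in E].
Proof. by rewrite !inE. Qed.

Lemma pairUC E x y : pairU E x y = pairU E y x.
Proof. by rewrite /pairU fsetUCA. Qed.

Lemma fsubset_card2 E A : E `<=` A -> #|` A| = #|` E|.+2 ->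
  exists x y, [/\ x != y, x \notin E, y \notin E & A = pairU E x y].
Proof.
move=> s c; have : #|` A `\` E| != 0 by rewrite cardfsDS // c; lia.
rewrite cardfs_eq0 => /fset0Pn [x]; rewrite !inE => /andP [xE xA].
have [||y yE ->] := @fsubset_card1 (x |` E) A.
- by apply/fsubsetP => j; rewrite !inE => /predU1P [->//|]; apply/fsubsetP.
- by rewrite cardfsU1 xE c.
move: yE; rewrite !inE negb_or => /andP [yx yE]; exists y, x; split=> //.
Qed.

Lemma pairU_neq E x y z t : x \notin E -> x != z -> x != t -> pairU E x y != pairU E z t.
Proof.
move=> /negbTE xE /negbTE xz /negbTE xt; apply/eqP => /fsetP/(_ x).
by rewrite !in_pairU eqxx xz xt xE.
Qed.

(** * The three pairings of a four-element eta_1 *)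

Section FourSplits.
Variables (k : nat) (w : {fsfun nat -> nat}) (u : {cmonom xt}) (E : {fset nat}) (a b c d : nat).
Hypotheses (aE : a \notin E) (bE : b \notin E) (cE : c \notin E) (dE : d \notin E).
Hypotheses (ab : a != b) (ac : a != c) (ad : a != d) (bc : b != c) (bd : b != d) (cd : c != d).
Hypotheses (uE : exps_of u [fset a; b; c; d] E) (ck : k = #|` E|.+2).
Let X := pairU E.

Definition valid2 x y z t := in_A k w (pairU E x y) && in_A k w (pairU E z t).

Let sp x y z t : perm_eq [:: x; y; z; t] [:: a; b; c; d] -> splits u (X x y) (X z t).
Proof.
move=> pe j; rewrite uE !in_pairU.
have un : uniq [:: x; y; z; t].
  by rewrite (perm_uniq pe) /= !inE !negb_or ab ac ad bc bd cd.
have nE y' : y' \in [:: x; y; z; t] -> y' \notin E.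
  by rewrite (perm_mem pe) !inE; case/or4P => /eqP ->.
have -> : (j \in [fset a; b; c; d]) = (j \in [:: x; y; z; t]).
  by rewrite (perm_mem pe) !inE -!orbA.
case: (boolP (j \in [:: x; y; z; t])) => jx.
  rewrite (negbTE (nE _ jx)) !orbF.
  have /= := un; rewrite !inE !negb_or => /and4P [/and3P [xy xz xt] /andP [yz yt] zt _].
  move: jx; rewrite !inE; case/or4P => /eqP ->; rewrite ?eqxx ?orbT /=;
    rewrite ?[y == x]eq_sym ?[z == x]eq_sym ?[t == x]eq_sym ?[z == y]eq_sym ?[t == y]eq_sym;
    by rewrite ?(negbTE xy) ?(negbTE xz) ?(negbTE xt) ?(negbTE yz) ?(negbTE yt).
move: jx; rewrite !inE !negb_or => /and4P [/negbTE -> /negbTE -> /negbTE -> /negbTE ->] /=.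
by rewrite mul2n -addnn.
Qed.

Let pe1 : perm_eq [:: a; b; c; d] [:: a; b; c; d]. Proof. by []. Qed.
Let pe2 : perm_eq [:: a; c; b; d] [:: a; b; c; d].
Proof. by rewrite perm_cons (perm_catCA [:: c] [:: b] [:: d]). Qed.
Let pe3 : perm_eq [:: a; d; b; c] [:: a; b; c; d].
Proof. by rewrite perm_cons (perm_catC [:: d] [:: b; c]). Qed.

Let valid_of A B : splits u A B -> in_A k w A -> in_A k w B ->
  [\/ (A = X a b \/ A = X c d) /\ valid2 a b c d,
      (A = X a c \/ A = X b d) /\ valid2 a c b d |
      (A = X a d \/ A = X b c) /\ valid2 a d b c].
Proof.
move=> s hA hB; have [s1 s2] := splits_exps_of uE s.
have [|x [y [xy xE yE EA]]] := fsubset_card2 s1; first by rewrite (card_in_A hA).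
have mem z : z \notin E -> z \in A -> [\/ z = a, z = b, z = c | z = d].
  move=> zE /(fsubsetP s2); rewrite !inE (negbTE zE) orbF -!orbA.
  by case/or4P => /eqP ->; [constructor 1|constructor 2|constructor 3|constructor 4].
have {}EA : A = X x y := EA.
have C z t z' t' : perm_eq [:: z; t; z'; t'] [:: a; b; c; d] -> A = X z t ->
    in_A k w (X z t) /\ in_A k w (X z' t').
  by move=> pe Ez; rewrite -(splits_inj s (B' := X z' t')) -?Ez // Ez; apply: sp.
have C' z t z' t' : perm_eq [:: z; t; z'; t'] [:: a; b; c; d] -> A = X z' t' ->
    in_A k w (X z t) /\ in_A k w (X z' t').
  move=> pe Ez; rewrite -(splits_inj s (B' := X z t)) -?Ez // Ez.
  exact/splitsC/sp.
have K z t z' t' : perm_eq [:: z; t; z'; t'] [:: a; b; c; d] ->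
    (A = X z t \/ A = X z' t') -> (A = X z t \/ A = X z' t') /\ valid2 z t z' t'.
  by move=> pe o; split=> //; rewrite /valid2; case: o => /[dup] EE; [case/(C _ _ _ _ pe)|case/(C' _ _ _ _ pe)] => -> ->.
have [||||] := mem x xE _; first by rewrite EA in_pairU eqxx.
all: move=> Ex; have [||||] := mem y yE _; first by rewrite EA in_pairU eqxx orbT.
all: move=> Ey; move: xy EA; rewrite Ex Ey ?eqxx // => _ EA.
- by constructor 1; apply: K; auto.
- by constructor 2; apply: K; auto.
- by constructor 3; apply: K; auto.
- by constructor 1; apply: K => //; left; rewrite EA /X pairUC.
- by constructor 3; apply: K; auto.
- by constructor 2; apply: K; auto.
- by constructor 2; apply: K => //; left; rewrite EA /X pairUC.
- by constructor 3; apply: K => //; right; rewrite EA /X pairUC.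
- by constructor 1; apply: K; auto.
- by constructor 3; apply: K => //; left; rewrite EA /X pairUC.
- by constructor 2; apply: K => //; right; rewrite EA /X pairUC.
- by constructor 1; apply: K => //; right; rewrite EA /X pairUC.
Qed.

Let same A B A' B' z t z' t' : perm_eq [:: z; t; z'; t'] [:: a; b; c; d] ->
  splits u A B -> splits u A' B' -> (A = X z t \/ A = X z' t') -> (A' = X z t \/ A' = X z' t') ->
  A = A' \/ A = B'.
Proof.
move=> pe s s' [EA|EA] [EA'|EA']; rewrite ?EA ?EA'; auto; right.
  by apply: (splits_inj (u := u) (A := A')) => //; rewrite EA'; apply/splitsC/sp.
by apply: (splits_inj (u := u) (A := A')) => //; rewrite EA'; apply/sp.
Qed.

(** Each splitting comes from one of the three pairings of a, b, c, d. Two splittings from the same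
    pairing agree up to order, so the distinctness conditions ask for two different valid
    pairings. *)
Lemma two_splits_eqP : two_splits k k w u <->
  [|| valid2 a b c d && valid2 a c b d, valid2 a b c d && valid2 a d b c |
      valid2 a c b d && valid2 a d b c].
Proof.
split.
  move=> [A [A' [B [B' [[hA hA' hB hB'] [s s' [/eqP n1 /eqP n2 _ _]]]]]]].
  have [] := valid_of s hA hB; have [] := valid_of s' hA' hB' => -[o' v'] [o v]; rewrite ?v ?v' ?orbT //.
  + by have [] := same pe1 s s' o o'.
  + by have [] := same pe2 s s' o o'.
  + by have [] := same pe3 s s' o o'.
have mk x y z t x' y' z' t' : perm_eq [:: x; y; z; t] [:: a; b; c; d] ->
    perm_eq [:: x'; y'; z'; t'] [:: a; b; c; d] -> valid2 x y z t -> valid2 x' y' z' t' ->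
    X x y != X x' y' -> X x y != X z' t' -> X z t != X x' y' -> X z t != X z' t' -> two_splits k k w u.
  move=> p1 p2 /andP [v1 v2] /andP [v1' v2'] n1 n2 n3 n4.
  exists (X x y), (X x' y'), (X z t), (X z' t'); split=> //.
  by split=> //; apply: sp.
have ba : b != a by rewrite eq_sym. have ca : c != a by rewrite eq_sym.
have da : d != a by rewrite eq_sym. have cb : c != b by rewrite eq_sym.
have db : d != b by rewrite eq_sym. have dc : d != c by rewrite eq_sym.
case/or3P => /andP [v v'].
- apply: (mk _ _ _ _ _ _ _ _ pe1 pe2 v v'); rewrite /X.
  + by rewrite (pairUC _ a b); apply: pairU_neq.
  + exact: pairU_neq.
  + by rewrite (pairUC _ c d); apply: pairU_neq.
  + exact: pairU_neq.
- apply: (mk _ _ _ _ _ _ _ _ pe1 pe3 v v'); rewrite /X.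
  + by rewrite (pairUC _ a b); apply: pairU_neq.
  + exact: pairU_neq.
  + exact: pairU_neq.
  + by rewrite (pairUC _ c d); apply: pairU_neq.
- apply: (mk _ _ _ _ _ _ _ _ pe2 pe3 v v'); rewrite /X.
  + by rewrite (pairUC _ a c); apply: pairU_neq.
  + exact: pairU_neq.
  + exact: pairU_neq.
  + by rewrite (pairUC _ b d); apply: pairU_neq.
Qed.

End FourSplits.

Lemma in_A_pairU k w E x y : injective w -> x != y -> x \notin E -> y \notin E -> k = #|` E|.+2 ->
  reflect (forall m, cnt (wset k w) m <= cnt E m + (x < m) + (y < m)) (in_A k w (pairU E x y)).
Proof.
move=> wI xy xE yE ck.
have xyE : x \notin y |` E by rewrite !inE negb_or xy.
have C m : cnt (pairU E x y) m = cnt E m + (x < m) + (y < m).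
  by rewrite /pairU !cntU1 // addnAC.
apply: (iffP (in_AP _ _ wI)) => [[_ h] m|h]; first by rewrite -C.
by split=> [|m]; rewrite ?C // /pairU cardfsU1 xyE cardfsU1 yE ck.
Qed.

Lemma in_A_add1 k w E x : injective w -> x \notin E -> k = #|` E|.+1 ->
  reflect (forall m, cnt (wset k w) m <= cnt E m + (x < m)) (in_A k w (x |` E)).
Proof.
move=> wI xE ck; apply: (iffP (in_AP _ _ wI)) => [[_ h] m|h]; first by rewrite -cntU1.
by split=> [|m]; rewrite ?cntU1 // cardfsU1 xE ck.
Qed.

Lemma in_A_rem1 l w E1 E2 x : injective w -> [disjoint E1 & E2] -> x \in E1 ->
  #|` E1| + #|` E2| = l.+1 ->
  reflect (forall m, cnt (wset l w) m + (x < m) <= cnt E1 m + cnt E2 m)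
    (in_A l w ((E1 `|` E2) `\ x)).
Proof.
move=> wI d xE cl; have xU : x \in E1 `|` E2 by rewrite inE xE.
have c : #|` (E1 `|` E2) `\ x| = l.
  have := cardfsD1 x (E1 `|` E2); rewrite xU cardfsU.
  by have /eqP -> := d; rewrite cardfs0; lia.
apply: (iffP (in_AP _ _ wI)) => [[_ h] m|h].
  by rewrite -cntUd // -(cntD1 m xU) leq_add2r.
by split=> // m; rewrite -(leq_add2r (x < m)) cntD1 // cntUd.
Qed.

(** * Comparing the splittings allowed by w and by s_i w *)

Section Mid.
Variables (i : nat) (w : {fsfun nat -> nat}).
Hypotheses (wI : injective w) (up : perm_len w < perm_len (fsfun_comp (simple i) w)).
Let w' := fsfun_comp (simple i) w.

Section Lt.
Variables (k l : nat) (u : {cmonom xt}) (E1 E2 : {fset nat}).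
Hypotheses (uE : exps_of u E1 E2) (d12 : [disjoint E1 & E2]) (i0 : i \in E1) (i1 : i.+1 \in E1).
Hypotheses (kl : k < l) (ck : k = #|` E2|.+1) (cE : #|` E1| + 2 * #|` E2| = k + l).

Let cl : #|` E1| + #|` E2| = l.+1. Proof. by move: cE ck; lia. Qed.
Let notE2 x : x \in E1 -> x \notin E2. Proof. by move/fdisjointP: d12; apply. Qed.
Let E := E1 `|` E2.

Let sactA : sact i (i.+1 |` E2) = i |` E2.
Proof.
apply/fsetP => j; rewrite mem_sact !inE simpleE.
case: (eqVneq j i) => [->|ji]; first by rewrite !eqxx.
case: (eqVneq j i.+1) => [->|ji1] /=; last by rewrite ?(negbTE ji) ?(negbTE ji1).
by rewrite eqnS (negbTE (notE2 i0)) (negbTE (notE2 i1)).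
Qed.

Let sactB : sact i (E `\ i) = E `\ i.+1.
Proof.
apply/fsetP => j; rewrite mem_sact !inE simpleE.
case: (eqVneq j i) => [->|ji]; first by rewrite eqSn eqnS i0 i1.
by case: (eqVneq j i.+1) => [->|ji1] /=; rewrite ?eqxx // ji.
Qed.

(** Since A(s_i w) is s_i-stable, i and i+1 are valid for s_i w together; every other b has the same
    validity for both permutations. So only what [w] allows at i and i+1 has to be compared. *)
Lemma two_splits_mid_lt : let r := newA i w k (i.+1 |` E2) && newA i w l (E `\ i) in
  (r -> two_splits k l w' u /\ ~ two_splits k l w u) /\ (~~ r -> two_splits k l w' u -> two_splits k l w u).
Proof.
have ck' : k = #|` E2|.+1 := ck.
rewrite /= !newAE // sactA sactB.
have A1 : in_A k w' (i |` E2) = in_A k w (i |` E2) by apply: in_A_low; rewrite ?inE ?eqxx.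
have A2 : in_A k w' (i.+1 |` E2) = in_A k w (i |` E2).
  by rewrite -A1 -sactA in_A_comp_sact.
have B1 : in_A l w' (E `\ i.+1) = in_A l w (E `\ i.+1) by apply: in_A_low; rewrite // !inE ?eqxx.
have B2 : in_A l w' (E `\ i) = in_A l w (E `\ i.+1).
  by rewrite -B1 -sactB in_A_comp_sact.
have J b : b != i -> b != i.+1 -> valid1 k l w' E1 E2 b = valid1 k l w E1 E2 b.
  move=> b1 b2; rewrite /valid1; congr (_ && _); apply: in_A_low => //.
    by rewrite !inE eq_sym (negbTE b2) (negbTE (notE2 i1)).
  by move=> _; rewrite !inE eq_sym b1 i0.
rewrite !(two_splits_ltP _ uE d12 kl ck').
have P := in_A_add1 wI (notE2 i0) ck'; have Q := in_A_add1 wI (notE2 i1) ck'.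
have R := in_A_rem1 wI d12 i1 cl; have S := in_A_rem1 wI d12 i0 cl.
(* The conditions for i and i+1 differ only at threshold i+1, so if just one of them fails, it fails
   there. *)
have nQ : in_A k w (i |` E2) -> ~~ in_A k w (i.+1 |` E2) -> cnt E2 i.+1 < cnt (wset k w) i.+1.
  move=> /P p; apply: contraR; rewrite -leqNgt => h; apply/Q => m.
  by case: (eqVneq m i.+1) => [->|mi]; [rewrite ltnn addn0 | move: (p m) mi; clear; lia].
have nS : in_A l w (E `\ i.+1) -> ~~ in_A l w (E `\ i) ->
    cnt E1 i.+1 + cnt E2 i.+1 <= cnt (wset l w) i.+1.
  move=> /R r; apply: contraR; rewrite -ltnNge => h; apply/S => m.
  case: (eqVneq m i.+1) => [->|mi]; first by rewrite ltnSn addn1.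
  by move: (r m) mi; clear; lia.
have ii : i != i.+1 by rewrite eqnS.
split=> [/andP [/andP [hp hq] /andP [hr hs]]|nr].
  split; first by exists i, i.+1; rewrite /valid1 A1 A2 B1 B2 hp hr.
  move=> [b [_ [bE _ _ /andP [v1 v2] _]]].
  (* At threshold i+1 the failure in A_k forces b <= i and the failure in A_l forces b > i, so no b
     is valid for [w]. *)
  have /(in_A_add1 wI (notE2 bE) ck') /(_ i.+1) := v1.
  have /(in_A_rem1 wI d12 bE cl) /(_ i.+1) := v2.
  by move: (nQ hp hq) (nS hr hs); clear; case: ltnP; lia.
move=> [b [b' [bE b'E ne vb vb']]].
have [/andP [hp hr]|npr] := boolP (in_A k w (i |` E2) && in_A l w (E `\ i.+1)); last first.
  (* If i and i+1 are not valid for s_i w, both given splittings are already allowed by [w]. *)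
  have off c : valid1 k l w' E1 E2 c -> (c != i) && (c != i.+1).
    move=> vc; apply/andP; split; apply: contraNneq npr => E0; move: vc.
      by rewrite E0 /valid1 A1 B2.
    by rewrite E0 /valid1 A2 B1.
  have /andP [b1 b2] := off _ vb; have /andP [b1' b2'] := off _ vb'.
  by exists b, b'; rewrite -!J.
move: nr; rewrite hp hr /= negb_and !negbK.
have VW := @wset_sub w l k (ltnW kl).
have cV : #|` wset k w| = k.
  by rewrite (perm_size (perm_wset k wI)) size_map size_iota.
(* At least one of i and i+1 is valid for [w]; if only one is, the interlacing lemmas supply a
   second element, above i+1 or below i. *)
have [hq|nq] := boolP (in_A k w (i.+1 |` E2)).
  have [hs _|ns _] := boolP (in_A l w (E `\ i)).
    by exists i, i.+1; rewrite /valid1 hp hq hr hs.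
  have [|e [eE ie h1 h2]] := interlace_up VW i1 (elimT R hr) (elimT Q hq) (nS hr ns).
    by rewrite cV ck'.
  exists i.+1, e; split=> //; first by rewrite neq_ltn ie.
    by rewrite /valid1 hq hr.
  by apply/andP; split; [apply/(in_A_add1 wI (notE2 eE) ck')|apply/(in_A_rem1 wI d12 eE cl)].
move=> /= hs.
have [e [eE ie h1 h2]] := interlace_down VW i0 (notE2 i0) (elimT P hp) (elimT S hs) (nQ hp nq).
exists i, e; split=> //; first by rewrite neq_ltn ie orbT.
  by rewrite /valid1 hp hs.
by apply/andP; split; [apply/(in_A_add1 wI (notE2 eE) ck')|apply/(in_A_rem1 wI d12 eE cl)].
Qed.

End Lt.

Section Eq.
Variables (k : nat) (u : {cmonom xt}) (E : {fset nat}) (a b : nat).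
Hypotheses (iE : i \notin E) (i1E : i.+1 \notin E) (aE : a \notin E) (bE : b \notin E).
Hypotheses (ai : a != i) (ai1 : a != i.+1) (bi : b != i) (bi1 : b != i.+1) (ab : a != b).
Hypotheses (uE : exps_of u [fset i; i.+1; a; b] E) (ck : k = #|` E|.+2).

Let sactP x : x != i -> x != i.+1 -> sact i (pairU E i.+1 x) = pairU E i x.
Proof.
move=> xi xi1; apply/fsetP => j; rewrite mem_sact !in_pairU simpleE.
case: (eqVneq j i) => [->|ji]; first by rewrite !eqxx.
case: (eqVneq j i.+1) => [->|ji1]; last by rewrite (negbTE ji1).
by rewrite eqnS [i == x]eq_sym [i.+1 == x]eq_sym (negbTE xi) (negbTE xi1) (negbTE iE) (negbTE i1E).
Qed.

(** The inequality for {i+1, y} fails at threshold i+1; comparison with the valid {i+1, x} gives x <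
    i and i+1 < y. Then {i, i+1} and {x, y} are both entrywise at most the valid {i, y}. *)
Let cross x y : x != i -> x != i.+1 -> y != i -> y != i.+1 -> x != y ->
  x \notin E -> y \notin E ->
  in_A k w (pairU E i x) -> in_A k w (pairU E i y) -> in_A k w (pairU E i.+1 x) ->
  ~~ in_A k w (pairU E i.+1 y) -> valid2 k w E i i.+1 x y.
Proof.
move=> xi xi1 yi yi1 xy xE yE.
have G z t := @in_A_pairU k w E z t wI.
have ix : i != x by rewrite eq_sym. have iy : i != y by rewrite eq_sym.
have i1x : i.+1 != x by rewrite eq_sym. have i1y : i.+1 != y by rewrite eq_sym.
have ii : i != i.+1 by rewrite eqnS.
move=> /(G _ _ ix iE xE ck) px /(G _ _ iy iE yE ck) py /(G _ _ i1x i1E xE ck) qx nq.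
have fail : cnt E i.+1 + (y < i.+1) < cnt (wset k w) i.+1.
  move: nq; apply: contraR; rewrite -leqNgt => h; apply/(G _ _ i1y i1E yE ck) => m.
  case: (eqVneq m i.+1) => [->|mi]; first by rewrite ltnn addn0.
  by move: (py m) mi; clear; lia.
have xlt : x < i by move: (qx i.+1) fail xi; clear; lia.
have ylt : i.+1 < y by move: (qx i.+1) fail yi yi1; clear; lia.
rewrite /valid2; apply/andP; split.
  apply/(G _ _ ii iE i1E ck) => m.
  by move: (qx m) (py m) xlt ylt; clear; lia.
by apply/(G _ _ xy xE yE ck) => m; move: (py m) (px m) (qx m) xlt ylt; clear; lia.
Qed.

Lemma two_splits_mid_eq : let r := newA i w k (pairU E i.+1 a) && newA i w k (pairU E i.+1 b) in
  (r -> two_splits k k w' u /\ ~ two_splits k k w u) /\ (~~ r -> two_splits k k w' u -> two_splits k k w u).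
Proof.
have ii : i != i.+1 by rewrite eqnS.
have ia : i != a by rewrite eq_sym. have ib : i != b by rewrite eq_sym.
have i1a : i.+1 != a by rewrite eq_sym. have i1b : i.+1 != b by rewrite eq_sym.
rewrite /= !newAE // !sactP //.
have BE w0 := two_splits_eqP w0 iE i1E aE bE ii ia ib i1a i1b ab uE ck; rewrite !BE {BE}.
have L x y : (i.+1 \in pairU E x y -> i \in pairU E x y) ->
  in_A k w' (pairU E x y) = in_A k w (pairU E x y) by apply: in_A_low.
have A x : x != i -> x != i.+1 -> in_A k w' (pairU E i x) = in_A k w (pairU E i x).
  by move=> _ _; apply: L; rewrite !in_pairU eqxx.
have B x : x != i -> x != i.+1 -> in_A k w' (pairU E i.+1 x) = in_A k w (pairU E i x).
  by move=> h1 h2; rewrite -A // -sactP // in_A_comp_sact.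
have V1 : valid2 k w' E i i.+1 a b = valid2 k w E i i.+1 a b.
  rewrite /valid2; congr (_ && _); apply: L; first by rewrite !in_pairU !eqxx.
  by rewrite !in_pairU (negbTE i1a) (negbTE i1b) (negbTE i1E).
have c1 := cross ai ai1 bi bi1 ab aE bE.
have c2 : in_A k w (pairU E i b) -> in_A k w (pairU E i a) -> in_A k w (pairU E i.+1 b) ->
    ~~ in_A k w (pairU E i.+1 a) -> valid2 k w E i i.+1 a b.
  rewrite /valid2 (pairUC E a b); apply: cross => //; by rewrite eq_sym.
rewrite !V1; move: c1 c2; rewrite /valid2 !A // !B //.
(* Six memberships are left. For s_i w the two pairings separating i from i+1 are valid together;
   when [w] keeps only one of them, [c1] or [c2] makes the third pairing valid. *)
move: (in_A k w (pairU E i a)) (in_A k w (pairU E i b)) (in_A k w (pairU E i.+1 a)) (in_A k w (pairU E i.+1 b)).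
move: (in_A k w (pairU E i i.+1)) (in_A k w (pairU E a b)).
by case; case; case; case; case; case => //= c1 c2; split=> //;
  try (by have := c1 isT isT isT isT); try (by have := c2 isT isT isT isT).
Qed.

End Eq.
End Mid.

(** * The induction *)

(** A set has at most m elements below m, while the criterion for the identity demands at least m of
    them for each m <= l. *)
Lemma in_A_id l A : in_A l [fsfun of j => j] A -> A = [fset j in iota 0 l].
Proof.
have idI : injective ([fsfun of j => j] : {fsfun nat -> nat}) by move=> x y; rewrite !fsfun0E.
move=> /(in_AP _ _ idI) [cA h]; apply/esym/eqP; rewrite eqEfcard cA.
rewrite card_fseq undup_id ?iota_uniq // size_iota leqnn andbT.
have memw x : (x \in wset l [fsfun of j => j]) = (x < l).
  by apply/mem_wset/idP => [[j jl <-]|xl]; [rewrite fsfun0E | exists x; rewrite ?fsfun0E].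
have full m : m <= l -> cnt (wset l [fsfun of j => j]) m = m.
  by elim: m => [|m IH] ml; rewrite ?cnt0 // cntS memw IH ?(ltnW ml) // ml addn1.
have le m : cnt A m <= m.
  by elim: m => [|m IH]; rewrite ?cnt0 // cntS; case: (m \in A); lia.
apply/fsubsetP => x; rewrite !inE /= mem_iota add0n => /= xl.
by have := h x.+1; rewrite full // cntS; have := le x; case: (x \in A); lia.
Qed.

(** The second clause is the range of the theorem, with [(k == l)] merging its two cases. The first,
    vanishing for larger eta_2, feeds the induction, since pi_i brings in monomials with one more
    double element. *)
Definition coef_formula w p := forall k l u (E1 E2 : {fset nat}), 0 < k -> k <= l ->
  has_T u k l -> exps_of u E1 E2 -> [disjoint E1 & E2] -> #|` E1| + 2 * #|` E2| = k + l ->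
  (k <= #|` E2| + (k == l) -> p@_u = 0%R) /\
  (k = #|` E2| + 1 + (k == l) ->
     (two_splits k l w u -> p@_u = (-1)%R) /\ (~ two_splits k l w u -> p@_u = 0%R)).

Definition invariant w p := [/\ tdeg_le1 p,
  forall u j, tdeg u = 2 -> 2 < u (inl j) -> p@_u = 0%R & coef_formula w p].

Lemma tdeg_has_T u k l : 0 < k -> k <= l -> has_T u k l -> tdeg u = 2.
Proof. by move=> k0 kl h; rewrite /tdeg h k0 (leq_trans k0 kl). Qed.

Lemma invariant_id : invariant [fsfun of j => j] 1%R.
Proof.
have one u : tdeg u != 0 -> (1 : poly_xt)@_u = 0%R.
  by move=> du; rewrite mcoeff1 (_ : (u == _) = false) //; apply: contraNF du => /eqP ->; rewrite /tdeg cm1.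
split=> [|u j du _|k l u E1 E2 k0 kl uT _ _ _]; first split=> [u _|u du].
- by rewrite mcoeff1.
- by rewrite one ?du.
- by rewrite one ?du.
have z : (1 : poly_xt)@_u = 0%R by rewrite one ?(tdeg_has_T k0 kl uT).
(* A_l(Id) has a single element, so no two splittings with distinct parts exist. *)
split=> // _; split=> // -[A [A' [B [B' [[/in_A_id -> /in_A_id -> _ _] [_ _ []]]]]]].
by rewrite eqxx.
Qed.

Section Step.
Variables (i : nat) (w : {fsfun nat -> nat}) (p : poly_xt).
Hypotheses (wI : injective w) (up : perm_len w < perm_len (fsfun_comp (simple i) w)).
Hypothesis (inv : invariant w p).
Let w' := fsfun_comp (simple i) w.
Let p' := demazure i (p * Nprod w i).
Let pt : tdeg_le1 p. Proof. by case: inv. Qed.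
Let p3 u j : tdeg u = 2 -> 2 < u (inl j) -> p@_u = 0%R. Proof. by case: inv => _ h _; apply: h. Qed.
Let pc : coef_formula w p. Proof. by case: inv. Qed.

Section Formula.
Variables (k l : nat).
Hypotheses (k0 : 0 < k) (kl : k <= l).

Lemma formula_low u E1 E2 : has_T u k l -> exps_of u E1 E2 -> [disjoint E1 & E2] ->
  #|` E1| + 2 * #|` E2| = k + l -> u (inl i.+1) = 0 \/ u (inl i) = 2 ->
  (k <= #|` E2| + (k == l) -> p'@_u = 0%R) /\
  (k = #|` E2| + 1 + (k == l) ->
     (two_splits k l w' u -> p'@_u = (-1)%R) /\ (~ two_splits k l w' u -> p'@_u = 0%R)).
Proof.
move=> uT uE d cE low.
have le j : u (inl j) <= 2.
  by rewrite uE; case: (boolP (j \in E1)) => [/(fdisjointP d)/negbTE ->|_] //; case: (_ \in _).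
rewrite (mcoeff_demazure_low wI up pt p3) //; last exact: tdeg_has_T k0 kl uT.
have [h1 h2] := pc k0 kl uT uE d cE; split=> // /h2 [h3 h4].
by split; [move/(two_splits_low wI up _ _ low) | move=> n; apply: h4; move/(two_splits_low wI up _ _ low)].
Qed.

Section Mid.
Variables (u : {cmonom xt}) (E1 E2 : {fset nat}).
Hypotheses (uT : has_T u k l) (uE : exps_of u E1 E2) (d : [disjoint E1 & E2]).
Hypotheses (cE : #|` E1| + 2 * #|` E2| = k + l) (i0 : i \in E1) (i1 : i.+1 \in E1).

Let i2 : i \notin E2. Proof. exact: (fdisjointP d). Qed.
Let i12 : i.+1 \notin E2. Proof. exact: (fdisjointP d). Qed.
Let F1 := (E1 `\ i) `\ i.+1.

Let cF : #|` E1| = #|` F1|.+2.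
Proof.
by rewrite (cardfsD1 i) i0 (cardfsD1 i.+1 (E1 `\ i)) !inE i1 eqSn.
Qed.

(** [x] is the one of i, i+1 that becomes double and joins eta_2; [y] is the one that disappears. *)
Let uE_set x y : x = i /\ y = i.+1 \/ x = i.+1 /\ y = i ->
  exps_of (setx i u (2 * (i == x)) (2 * (i.+1 == x))) F1 (x |` E2).
Proof.
move=> xy j; case: (eqVneq j i) => [->|ji].
  by rewrite setxl !inE eqxx !andbF add0n (negbTE i2) orbF.
case: (eqVneq j i.+1) => [->|ji1].
  by rewrite setxr !inE eqxx !add0n (negbTE i12) orbF.
rewrite setxo // uE !inE ji ji1 (_ : (j == x) = false) //.
by case: xy => -[-> _]; apply: negbTE.
Qed.

Let uEr : exps_of (setx i u 0 2) F1 (i.+1 |` E2).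
Proof. by have := @uE_set i.+1 i (or_intror _ (conj erefl erefl)); rewrite eqxx eqnS. Qed.

Let uEl : exps_of (setx i u 2 0) F1 (i |` E2).
Proof. by have := @uE_set i i.+1 (or_introl _ (conj erefl erefl)); rewrite eqxx eqSn. Qed.

Let has_T_setx a b : has_T (setx i u a b) k l.
Proof. by move=> j; rewrite setx_inr uT. Qed.

Let disj x : x \in [:: i; i.+1] -> [disjoint F1 & x |` E2].
Proof.
rewrite !inE => xi; apply/fdisjointP => y; rewrite !inE => /and3P [y1 y0 yE].
rewrite negb_or (fdisjointP d _ yE) andbT; case/orP: xi => /eqP -> //.
Qed.

(** Doubling i or i+1 raises |eta_2| by one, which lands in the vanishing clause for [p]. *)
Let formula_mid0 x : x \notin E2 -> x \in [:: i; i.+1] -> k <= #|` E2| + 1 + (k == l) ->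
  forall v, has_T v k l -> exps_of v F1 (x |` E2) -> p@_v = 0%R.
Proof.
move=> xE xi ck v vT vE; have [|h _] := pc k0 kl vT vE (disj xi).
  by rewrite cardfsU1 xE -cE cF; lia.
by apply: h; rewrite cardfsU1 xE; move: ck; lia.
Qed.

Lemma formula_midE : k <= #|` E2| + 1 + (k == l) ->
  p'@_u = (p@_u - (npairs (Nfactors w i) (setx i u 0 2))%:R)%R.
Proof.
move=> ck; rewrite (mcoeff_demazure_mid wI up pt).
- rewrite (@formula_mid0 i i2 _ ck _ (has_T_setx 2 0) uEl) ?inE ?eqxx //.
  by rewrite (@formula_mid0 i.+1 i12 _ ck _ (has_T_setx 0 2) uEr) ?inE ?eqxx ?orbT // addr0 subr0.
- exact: tdeg_has_T k0 kl uT.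
- by rewrite uE i0 (negbTE i2).
- by rewrite uE i1 (negbTE i12).
Qed.

Lemma formula_mid :
  (k <= #|` E2| + (k == l) -> p'@_u = 0%R) /\
  (k = #|` E2| + 1 + (k == l) ->
     (two_splits k l w' u -> p'@_u = (-1)%R) /\ (~ two_splits k l w' u -> p'@_u = 0%R)).
Proof.
have [h1 h2] := pc k0 kl uT uE d cE; split=> ck.
  rewrite formula_midE ?h1 //; last by move: ck; lia.
  (* Each part contains eta_2 and i+1. For k = l both parts then equal this set of size |eta_2| + 1;
     for k < l it does not fit into the part of size k. *)
  rewrite (npairs_Nfactors_none wI up kl (has_T_setx 0 2)) ?subr0 // => A B cA cB s E.
    have cU : #|` i.+1 |` E2| = #|` E2|.+1 by rewrite cardfsU1 i12.
    have [sA _] := splits_exps_of uEr s; have [sB _] := splits_exps_of uEr (splitsC s).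
    have le : k <= #|` i.+1 |` E2| by rewrite cU; move: ck; rewrite E eqxx addn1.
    by rewrite (fsubset_card0 sA) ?cA // (fsubset_card0 sB) // cB -E.
  have [sA _] := splits_exps_of uEr s; have := fsubset_leq_card sA.
  by rewrite cA cardfsU1 i12; move: ck; rewrite (ltn_eqF E); clear; lia.
have {h2} [h3 h4] := h2 ck.
(* The number of pairs is at most one; it must be 1 exactly when eta enters B_{k,l} on passing from
   [w] to s_i w. *)
suff [r [rE r1 r2]] : exists r : bool, [/\ npairs (Nfactors w i) (setx i u 0 2) = r,
    r -> two_splits k l w' u /\ ~ two_splits k l w u & ~~ r -> two_splits k l w' u -> two_splits k l w u].
  rewrite formula_midE ?rE -?ck //; case: r r1 r2 rE => [/(_ isT) [b' nb] _ _|_ /(_ isT) r2 _].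
    by split=> // _; rewrite h4 // sub0r.
  rewrite subr0; split=> [/r2/h3 //|n]; apply: h4 => b; apply: n; exact: (two_splits_mono wI up b).
move: kl; rewrite leq_eqVlt => /predU1P [ekl|ltkl]; last first.
  rewrite (ltn_eqF ltkl) addn0 addn1 in ck.
  have [m1 m2] := two_splits_mid_lt wI up uE d i0 i1 ltkl ck cE.
  exists (newA i w k (i.+1 |` E2) && newA i w l ((E1 `|` E2) `\ i)); split=> //.
  have s0 : splits (setx i u 0 2) (i.+1 |` E2) ((E1 `|` E2) `\ i).
    move=> j; rewrite uEr !inE; case: (eqVneq j i) => [->|ji].
      by rewrite eqnS (negbTE i2) !andbF.
    case: (eqVneq j i.+1) => [->|ji1] /=; first by rewrite i1.
    by case: (boolP (j \in E1)) => [/(fdisjointP d)/negbTE ->|_] //; case: (j \in E2).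
  rewrite (npairs_Nfactors_one wI up k0 kl (has_T_setx 0 2) s0) // => [|A B cA cB s].
    by move=> e; rewrite e ltnn in ltkl.
  (* The part of size k contains eta_2 and i+1, already k elements, so the splitting is
     determined. *)
  left; have [sA _] := splits_exps_of uEr s; have EA : A = i.+1 |` E2.
    by apply: fsubset_card0 => //; rewrite cA cardfsU1 i12 ck.
  by split=> //; apply: splits_inj s0; rewrite -EA.
have {}ck : k = #|` E2|.+2 by move: ck; rewrite ekl eqxx; lia.
have [a [b [ab aI bI E1E]]] : exists a b,
    [/\ a != b, a \notin [fset i; i.+1], b \notin [fset i; i.+1] & E1 = pairU [fset i; i.+1] a b].
  apply: fsubset_card2; first by apply/fsubsetP => j; rewrite !inE => /orP [] /eqP ->.
  by rewrite cardfs2 eqnS /=; move: cE ck; rewrite -ekl; clear; set x := #|` E1|; set y := #|` E2|; lia.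
have aE : a \in E1 by rewrite E1E in_pairU eqxx.
have bE : b \in E1 by rewrite E1E in_pairU eqxx orbT.
move: aI bI; rewrite !inE !negb_or => /andP [ai ai1] /andP [bi bi1].
have aE2 := fdisjointP d _ aE; have bE2 := fdisjointP d _ bE.
have uE4 : exps_of u [fset i; i.+1; a; b] E2.
  move=> j; rewrite uE E1E in_pairU !inE; congr (nat_of_bool _ + _).
  by case: (j == i); case: (j == i.+1); case: (j == a); case: (j == b).
have [m1 m2] := two_splits_mid_eq wI up i2 i12 aE2 bE2 ai ai1 bi bi1 ab uE4 ck.
rewrite -ekl; exists (newA i w k (pairU E2 i.+1 a) && newA i w k (pairU E2 i.+1 b)).
split=> //.
have F1E j : (j \in F1) = (j == a) || (j == b).
  rewrite !inE E1E in_pairU !inE; case: (eqVneq j i.+1) => [->|_] /=.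
    by rewrite ![i.+1 == _]eq_sym (negbTE ai1) (negbTE bi1).
  case: (eqVneq j i) => [->|_] /=; last by rewrite orbF.
  by rewrite ![i == _]eq_sym (negbTE ai) (negbTE bi).
have s0 : splits (setx i u 0 2) (pairU E2 i.+1 a) (pairU E2 i.+1 b).
  move=> j; rewrite uEr F1E !in_pairU !inE.
  case: (eqVneq j i.+1) => [->|ji1] /=.
    by rewrite ![i.+1 == _]eq_sym (negbTE ai1) (negbTE bi1).
  case: (eqVneq j a) => [->|ja] /=; first by rewrite (negbTE ab) (negbTE aE2).
  by case: (eqVneq j b) => [->|jb] /=; [rewrite (negbTE bE2) | case: (j \in E2)].
have uT' : has_T (setx i u 0 2) k k by rewrite {2}ekl; apply: has_T_setx.
rewrite (npairs_Nfactors_one wI up k0 (leqnn k) uT' s0) // => [|A B cA cB s].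
  move=> _; apply/eqP; rewrite (pairUC _ _ a); apply: pairU_neq => //.
have [sA sA'] := splits_exps_of uEr s.
(* Each part consists of eta_2, i+1 and one further element, [a] or [b]; exchanging these exchanges
   the two parts. *)
have [|x xn EA] := fsubset_card1 sA; first by rewrite cA cardfsU1 i12 ck.
have xab : (x == a) || (x == b).
  by rewrite -F1E; move/fsubsetP/(_ x): sA'; rewrite EA !in_fsetU !in_fset1 eqxx /= -in_fset1 -in_fsetU (negbTE xn) orbF; apply.
have EA' : A = pairU E2 i.+1 x by rewrite EA pairUC.
case/orP: xab => /eqP xE; rewrite xE in EA'.
  by left; split=> //; apply: splits_inj s0; rewrite -EA'.
right; split=> //; split=> //; apply: splits_inj (splitsC s0); rewrite -EA' //.
Qed.

End Mid.

End Formula.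

Lemma invariant_step : invariant w' p'.
Proof.
split; first exact (tdeg_le1_demazure wI up pt).
  by move=> u j du uj; apply: (mcoeff_demazure_big wI up pt p3 du uj).
move=> k l u E1 E2 k0 kl uT uE d cE.
have [i0|i0] := boolP ((u (inl i.+1) == 0) || (u (inl i) == 2)).
  by apply: formula_low => //; case/orP: i0 => /eqP; auto.
have [/andP [j0 j1]|i1] := boolP ((i \in E1) && (i.+1 \in E1)); first exact: formula_mid.
have sE j : simple i j \in E1 -> simple i j \notin E2 by apply: (fdisjointP d).
(* The exponents left at (i, i+1) are (0, 1), (0, 2) and (1, 2). Coefficient and splittings for s_i
   w are both s_i-invariant, so the swapped monomial, which falls under [formula_low], decides. *)
have := @formula_low k l k0 kl (swap_mon i u) (sact i E1) (sact i E2).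
rewrite !card_sact (mcoeff_demazure_swap i w p) => F.
have [|||||h1 h2] := F.
- by move=> j; rewrite swap_monE uT.
- by move=> j; rewrite swap_monE /= uE !mem_sact.
- by apply/fdisjointP => j; rewrite !mem_sact; apply: sE.
- exact: cE.
- rewrite !swap_monE /= simpleL simpleR; move: i0 i1 (sE i) (sE i.+1).
  rewrite simpleL simpleR !uE.
  by do 4!case: (_ \in _) => //=; auto => _ _ h h'; try (by have := h isT); try (by have := h' isT).
split=> // /h2 [h3 h4]; split=> [b|n]; first by apply/h3/(two_splits_swap wI up).
by apply: h4 => b; apply: n; apply/(two_splits_swap wI up).
Qed.

End Step.

Lemma is_P_invariant w p : is_P w p -> injective w /\ invariant w p.
Proof.
elim=> [|{}w {}p i _ [wI inv] up].
  by split; [move=> x y; rewrite !fsfun0E | exact: invariant_id].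
by split; [exact: comp_simple_inj | exact: invariant_step].
Qed.

Theorem theorem5p2 (w : {fsfun nat -> nat}) (w_inj : injective w)
    (Pw : poly_xt) (PwE : is_P w Pw) (k l : nat) (le_kl : k <= l)
    (eta1 eta2 : {fset nat}) (eta12 : [disjoint eta1 & eta2]%fset)
    (size_eta : #|` eta1| + 2 * #|` eta2| = k + l)
    (kl : (k < l /\ k = #|` eta2| + 1) \/ (l = k /\ k = #|` eta2| + 2))
    (eta := (seq_mset eta1 `+` (seq_mset eta2 `+` seq_mset eta2))%mset) :
  (in_B k l w eta -> mcoef Pw k l eta = 1%R) /\
  (~ in_B k l w eta -> mcoef Pw k l eta = 0%R).
Proof.
have [_ [_ _ pc]] := is_P_invariant PwE.
set u := mmul (xmon eta) (mmul (Tmon k) (Tmon l)).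
have etaE j : eta j = (j \in eta1) + 2 * (j \in eta2).
  by rewrite !msetE2 !mset_seqE !count_uniq_mem ?fset_uniq // mul2n -addnn.
have u_inl j : u (inl j) = eta j by rewrite !cmM xmon_inl !Tmon_inl !addn0 count_mem_mset.
have uT : has_T u k l by move=> j; rewrite !cmM xmon_inr !Tmon_inr.
have uE : exps_of u eta1 eta2 by move=> j; rewrite u_inl etaE.
have k0 : 0 < k by case: kl => -[]; lia.
have [_ []] := pc k l u eta1 eta2 k0 le_kl uT uE eta12 size_eta.
  (* Both cases of the hypothesis read k = |eta_2| + 1 + [k = l]. *)
  case: kl => -[]; first by move=> /ltn_eqF -> ->; rewrite addn0.
  by move=> -> ck; rewrite eqxx -addnA.
have BE : in_B k l w eta <-> two_splits k l w u.
  have sE A B : eta = (seq_mset A `+` seq_mset B)%mset <-> splits u A B.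
    split=> [E j|s]; first by rewrite u_inl E msetE2 !mset_seqE !count_uniq_mem ?fset_uniq.
    by apply/msetP => j; rewrite -u_inl s msetE2 !mset_seqE !count_uniq_mem ?fset_uniq.
  split=> -[A [A' [B [B' [[a a' b b'] [s s' n]]]]]]; exists A, A', B, B'.
    by rewrite -!mem_Aset; split=> //; split=> //; apply/sE.
  by rewrite !mem_Aset; split=> //; split=> //; apply/sE.
rewrite /mcoef -/u => h1 h2; split=> [/BE/h1 ->|n]; first by rewrite opprK.
by rewrite h2 ?oppr0 // => /BE.
Qed.
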